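(* The Lamplighter group $L=\langle a,x : a^2=1,\ [a,x^{-k}ax^k]=1 \text{ for all integers } k\rangle$ is not semistable at $\infty$ (as a finitely generated group). That is, there do not exist a finite generating set $S$ of $L$ and a finite set $\mathcal R\subset \ker(\phi)$ of $S$-relations for $L$, where $\phi:F(S)\to L$ is the canonical epimorphism from the free group on $S$, such that the 2-complex $\Gamma(L,S,\mathcal R)$ is semistable at $\infty$.
   Context: The complex $\Gamma(G,S,\mathcal R)$: let $G$ be a group with finite generating set $S$, let $F(S)$ be the free group on $S$, and let $\phi:F(S)\to G$ be the quotient map sending $s$ to $s$ for all $s\in S$. Let $\Gamma(G,S)$ be the Cayley graph of $G$ with respect to $S$: its vertex set is $G$, and for each $g\in G$ and $s\in S$ there is one oriented edge from $g$ to $gs$ labeled $s$ (traversing it backwards reads $s^{-1}$). If $\mathcal R=\{r_1,\ldots,r_m\}\subset\ker(\phi)$ is a finite set of $S$-relations for $G$, then $\Gamma(G,S,\mathcal R)$ is the 2-complex obtained from $\Gamma(G,S)$ by attaching, for each vertex $g$ and each $r_i\in\mathcal R$, a 2-cell along the edge path loop at $g$ labeled $r_i$ (so $m$ 2-cells are attached at each vertex). Semistability of spaces: all spaces considered are connected, 1-ended, locally finite CW-complexes. A proper edge path ray in $X$ is a proper map $r:[0,\infty)\to X$ such that for each integer $n\ge 0$, $r|_{[n,n+1]}$ is a linear homeomorphism onto an edge of $X$. Such an $X$ is semistable at $\infty$ if any two proper edge path rays in $X$ are properly homotopic. Equivalently: given any proper edge path ray $r$ in $X$ and finite subcomplex $C\subset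 X$, there is a finite subcomplex $D\subset X$ such that for any third finite subcomplex $E\subset X$ and any edge path loop $\alpha$ based on $r$ with image in $X-D$, the loop $\alpha$ is homotopic rel $r$ to a loop in $X-E$ by a homotopy in $X-C$ (here ''homotopic rel $r$'' means that the base point of the loop moves along $r$ during the homotopy, so $\alpha$ is homotopic rel endpoints to a path that follows $r$, then traverses the new loop, then returns along $r$). Semistability of finitely generated groups: a finitely generated 1-ended group $G$ is semistable at $\infty$ if there is a finite generating set $S$ for $G$ and a finite set $\mathcal R\subset\ker(\phi)$ of $S$-relations for $G$ such that $\Gamma(G,S,\mathcal R)$ is semistable at $\infty$. *)

(* Defs.v *)
From HB Require Import structures.
From mathcomp Require Import all_boot all_order all_algebra finmap.
From mathcomp Require Import generic_quotient.
From mathcomp Require Import all_classical all_reals all_analysis.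

Set Implicit Arguments.
Unset Strict Implicit.
Unset Printing Implicit Defensive.

Import Order.TTheory GRing.Theory Num.Theory.
Import numFieldNormedType.Exports.

Local Open Scope classical_set_scope.
Local Open Scope ring_scope.
Local Open Scope quotient_scope.

(* A letter is a pair (s, b): it stands for s if b = false and for s^-1 if
   b = true. *)
Notation word A := (seq (A * bool)).

Section Words.
Context {A : Type}.
Implicit Types (l : A * bool) (u v w : word A).

Definition linv l : A * bool := (l.1, ~~ l.2).
Definition winv w : word A := rev (map linv w).
Definition wpow w (k : int) : word A :=
  match k with
  | Posz n => flatten (nseq n w)
  | Negz n => flatten (nseq n.+1 (winv w))
  end.
Definition wcomm u v : word A := winv u ++ winv v ++ u ++ v.

(* u and v are equal modulo the normal closure of the relators in the free
   group on A. *)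
Inductive pres_eq (rels : set (word A)) : word A -> word A -> Prop :=
| pres_refl u : pres_eq rels u u
| pres_sym u v : pres_eq rels u v -> pres_eq rels v u
| pres_trans v u w : pres_eq rels u v -> pres_eq rels v w -> pres_eq rels u w
| pres_cat u u' v v' :
    pres_eq rels u u' -> pres_eq rels v v' -> pres_eq rels (u ++ v) (u' ++ v')
| pres_cancel l : pres_eq rels [:: l; linv l] [::]
| pres_rel r : rels r -> pres_eq rels r [::].

Lemma linvK : involutive linv.
Proof. by case=> s b; rewrite /linv negbK. Qed.

Lemma winvK : involutive winv.
Proof.
by move=> w; rewrite /winv map_rev revK (mapK linvK).
Qed.

Lemma pres_mulV rels w : pres_eq rels (w ++ winv w) [::].
Proof.
elim: w => [|l w IH]; first exact: pres_refl.
have -> : (l :: w) ++ winv (l :: w) = [:: l] ++ (w ++ winv w) ++ [:: linv l].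
  by rewrite /winv /= rev_cons -cats1 -catA.
apply: (@pres_trans _ ([:: l] ++ [::] ++ [:: linv l])); last exact: pres_cancel.
apply: pres_cat; first exact: pres_refl.
by apply: pres_cat IH _; exact: pres_refl.
Qed.

Lemma pres_Vmul rels w : pres_eq rels (winv w ++ w) [::].
Proof. by have := pres_mulV rels (winv w); rewrite winvK. Qed.

Lemma pres_winv rels u v : pres_eq rels u v -> pres_eq rels (winv u) (winv v).
Proof.
move=> uv; apply: (@pres_trans _ (winv u ++ v ++ winv v)).
  rewrite -[X in pres_eq _ X _]cats0; apply: pres_cat; first exact: pres_refl.
  exact/pres_sym/pres_mulV.
rewrite catA -[X in pres_eq _ _ X]cat0s.
apply: pres_cat; last exact: pres_refl.
apply: pres_trans (pres_Vmul rels u).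
by apply: pres_cat; [exact: pres_refl | exact: pres_sym].
Qed.

End Words.

Section Presentation.
Variables (A : choiceType) (rels : set (word A)).

Definition pres_eqb (u v : word A) : bool := `[< pres_eq rels u v >].

Lemma pres_eqb_equiv : equiv_class_of pres_eqb.
Proof.
split=> [u|u v|v u w].
- by apply/asboolP; exact: pres_refl.
- by apply/asboolP/asboolP; exact: pres_sym.
- by move=> /asboolP uv /asboolP vw; apply/asboolP; exact: pres_trans uv vw.
Qed.

Canonical pres_equiv := EquivRelPack pres_eqb_equiv.

(* The group <A | rels>. *)
Definition presented : Type := {eq_quot pres_equiv}.

HB.instance Definition _ := Choice.on presented.

Definition pres_class (w : word A) : presented := \pi_({eq_quot pres_equiv}) w.
Definition pres_word (g : presented) : word A := repr (g : {eq_quot pres_equiv}).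

Lemma pres_classP u v : pres_class u = pres_class v <-> pres_eq rels u v.
Proof.
split=> [/eqmodP/asboolP //|uv].
by apply/eqmodP/asboolP.
Qed.

Lemma pres_wordK g : pres_class (pres_word g) = g.
Proof. exact: reprK. Qed.

Lemma pres_classK w : pres_eq rels (pres_word (pres_class w)) w.
Proof. by apply/pres_classP; rewrite pres_wordK. Qed.

Definition pres_mul (g h : presented) : presented :=
  pres_class (pres_word g ++ pres_word h).
Definition pres_one : presented := pres_class [::].
Definition pres_inv (g : presented) : presented :=
  pres_class (winv (pres_word g)).

Lemma pres_mulE u v : pres_mul (pres_class u) (pres_class v) = pres_class (u ++ v).
Proof. by apply/pres_classP/pres_cat; exact: pres_classK. Qed.

Lemma pres_mulA : associative pres_mul.
Proof.
move=> f g h; rewrite -[f]pres_wordK -[g]pres_wordK -[h]pres_wordK.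
by rewrite !pres_mulE catA.
Qed.

Lemma pres_mul1 : left_id pres_one pres_mul.
Proof. by move=> g; rewrite -[g]pres_wordK pres_mulE. Qed.

Lemma pres_mulr1 : right_id pres_one pres_mul.
Proof. by move=> g; rewrite -[g]pres_wordK pres_mulE cats0. Qed.

Lemma pres_mulVg : left_inverse pres_one pres_inv pres_mul.
Proof.
move=> g; rewrite -{2}[g]pres_wordK pres_mulE.
exact/pres_classP/pres_Vmul.
Qed.

Lemma pres_mulgV : right_inverse pres_one pres_inv pres_mul.
Proof.
move=> g; rewrite -{1}[g]pres_wordK pres_mulE.
exact/pres_classP/pres_mulV.
Qed.

HB.instance Definition _ := isGroup.Build presented
  pres_mulA pres_mul1 pres_mulr1 pres_mulVg pres_mulgV.

End Presentation.

Inductive lamp_gen := gen_a | gen_x.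
HB.instance Definition _ := gen_eqMixin lamp_gen.
HB.instance Definition _ := gen_choiceMixin lamp_gen.

Definition lamp_rels : set (word lamp_gen) :=
  let a := [:: (gen_a, false)] in
  let x := [:: (gen_x, false)] in
  [set w | w = a ++ a \/
           exists k : int, w = wcomm a (wpow x (- k) ++ a ++ wpow x k)].

Definition lamplighter := presented lamp_rels.
HB.instance Definition _ := Group.on lamplighter.

(* The free group F(S), as the set of reduced words. *)
Definition reduced (A : eqType) (w : word A) : bool :=
  sorted (fun l m => m != linv l) w.

Definition free_group (A : eqType) := {w : word A | reduced w}.
HB.instance Definition _ (A : choiceType) := Choice.on (free_group A).

Section CayleyComplex.
Variables (R : realType) (G : groupType) (S : {fset G}).

Definition leval (l : S * bool) : G :=
  if l.2 then ((val l.1)^-1)%g else val l.1.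

Definition weval (w : word S) : G := foldr (fun l g => (leval l * g)%g) 1%g w.

Definition phi (w : free_group S) : G := weval (val w).

Definition generating_set : Prop := forall g : G, exists w, phi w = g.

(* CV is a vertex, CE g s t the point at parameter t of the open edge from g to
   gs labelled s, and CD g r p the point p of the open 2-cell attached at g
   along r. *)
Inductive cayley_complex (rels : {fset free_group S}) : Type :=
| CV of G
| CE of G & S & {t : R | 0 < t < 1}
| CD of G & rels & {p : R * R | p.1 ^+ 2 + p.2 ^+ 2 < 1}.

Variable rels : {fset free_group S}.
Local Notation X := (cayley_complex rels).

HB.instance Definition _ := gen_eqMixin X.
HB.instance Definition _ := gen_choiceMixin X.

(* Characteristic map [0, 1] -> X of the edge from g to gs labelled s. *)
Definition edge_map (g : G) (s : S) (t : R) : X :=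
  if insub t is Some u then CE rels g s u
  else if t <= 0 then CV rels g else CV rels (g * val s)%g.

(* The edge starting at g that reads the letter l, traversed over [0, 1]. *)
Definition letter_path (g : G) (l : S * bool) (t : R) : X :=
  if l.2 then edge_map (g * (val l.1)^-1)%g l.1 (1 - t) else edge_map g l.1 t.

(* The edge path at g that reads w, parametrized by [0, size w]. *)
Fixpoint word_path (g : G) (w : word S) (t : R) : X :=
  match w with
  | [::] => CV rels g
  | l :: w' => if t <= 1 then letter_path g l t
               else word_path (g * leval l)%g w' (t - 1)
  end.

(* For p = (cos (2 pi t), sin (2 pi t)) with 0 <= t < 1, turn p = t. *)
Definition turn (p : R * R) : R :=
  if 0 <= p.2 then acos p.1 / (2 * pi) else 1 - acos p.1 / (2 * pi).

Definition unit_disc : set (R * R) := [set p | p.1 ^+ 2 + p.2 ^+ 2 <= 1].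

(* Characteristic map D^2 -> X of the 2-cell attached at g along r. *)
Definition disc_map (g : G) (r : rels) (p : R * R) : X :=
  if insub p is Some u then CD g r u
  else let w := val (val r) in word_path g w ((size w)%:R * turn p).

(* The weak topology of the CW complex. *)
Definition cayley_open : set_system X := [set U |
  (forall g s,
     open (edge_map g s @^-1` U : set (subspace (`[0, 1] : set R)))) /\
  (forall g r,
     open (disc_map g r @^-1` U : set (subspace unit_disc)))].

Lemma cayley_openT : cayley_open setT.
Proof. by split=> *; rewrite preimage_setT; exact: openT. Qed.

Lemma cayley_openI : setI_closed cayley_open.
Proof.
move=> U V [U1 U2] [V1 V2].
by split=> *; rewrite preimage_setI; exact: openI.
Qed.

Lemma cayley_open_bigU (I : Type) (f : I -> set X) :
  (forall i, cayley_open (f i)) -> cayley_open (\bigcup_i f i).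
Proof.
move=> fo; split=> g s; rewrite preimage_bigcup; apply: bigcup_open => i _.
- exact: (fo i).1.
- exact: (fo i).2.
Qed.

HB.instance Definition _ :=
  isOpenTopological.Build X cayley_openT cayley_openI cayley_open_bigU.

Definition proper_on (T : topologicalType) (D : set T) (f : T -> X) : Prop :=
  {within D, continuous f} /\
  forall K : set X, compact K -> compact (D `&` f @^-1` K).

(* A ray is a function on R of which only the values on [0, +oo[ matter. *)
Definition proper_edge_path_ray (r : R -> X) : Prop :=
  proper_on (`[0, +oo[ : set R) r /\
  forall n : nat, exists g l,
    forall t, 0 <= t <= 1 -> r (n%:R + t) = letter_path g l t.

Definition properly_homotopic (r r' : R -> X) : Prop :=
  exists H : R * R -> X,
    [/\ proper_on ((`[0, +oo[ : set R) `*` (`[0, 1] : set R)) H,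
        forall t, 0 <= t -> H (t, 0) = r t &
        forall t, 0 <= t -> H (t, 1) = r' t].

Definition semistable_complex : Prop :=
  forall r r', proper_edge_path_ray r -> proper_edge_path_ray r' ->
    properly_homotopic r r'.

End CayleyComplex.

Definition semistable_group (R : realType) (G : groupType) : Prop :=
  exists (S : {fset G}) (rels : {fset free_group S}),
    [/\ generating_set S,
        forall r, r \in rels -> phi r = 1%g &
        semistable_complex R rels].

(* Main.v *)
(** Suppose X = Gamma(L, S, R) is semistable. Finitely many relators of L
imply R; choose n such that the commutators [a, x^-k a x^k] with |k| <= n
suffice, and let A be the finite group generated by the x^-i a x^i, |i| <= n.
Fox derivation on words in a and x with D(a) = 0 and D(x) = the indicator of A
vanishes on these commutators, because the indicator of A is invariant under
the x^-i a x^i; so for every y in L the coefficient of D at y is an integral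
1-cocycle c_y on X, of finite support. On the rays x^0, x^1, x^2, ... and x^0,
x^-1, x^-2, ... the cocycle of y = x^j, j >= 0, takes the values 1 and 0.

The cocycle c_y is the winding of a map theta_y from X to the circle that is
constant outside a compact set. Given a proper homotopy H between the two rays,
the path t |-> H(0, t) is compact, so theta_y stays close to its constant value
along it if y = x^j with j large; by properness theta_y o H is constant on
{T} x [0, 1] for large T. Lifting theta_y o H from [0, T] x [0, 1] to the line
then gives equal windings along both rays: a contradiction. *)

Require Import Defs.
From HB Require Import structures.
From mathcomp Require Import all_boot all_order all_algebra finmap.
From mathcomp Require Import all_classical all_reals all_analysis.
From mathcomp Require Import ring lra zify.

Set Implicit Arguments.
Unset Strict Implicit.
Unset Printing Implicit Defensive.

Import Order.TTheory GRing.Theory Num.Theory.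
Import numFieldNormedType.Exports.

Local Open Scope classical_set_scope.
Local Open Scope ring_scope.

(** * Fox derivations on the lamplighter group *)

Section EdgeCochains.
Variables (G : groupType) (S : {fset G}).
Implicit Types (c : G -> S -> int) (g : G) (l : S * bool) (w : word S).

(** An inverse letter read at [g] runs backwards along the edge that starts at g s^-1, hence the
    shifted base point and the sign. *)
Definition letter_val c g l : int :=
  if l.2 then - c (g * (val l.1)^-1)%g l.1 else c g l.1.

Fixpoint path_val c g w : int :=
  if w is l :: w' then letter_val c g l + path_val c (g * leval l)%g w' else 0.

Lemma weval_cat (u v : word S) : weval (u ++ v) = (weval u * weval v)%g.
Proof. by elim: u => [|l u IH]; rewrite ?mul1g //= IH mulgA. Qed.

Lemma path_val_cat c g u v :
  path_val c g (u ++ v) = path_val c g u + path_val c (g * weval u)%g v.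
Proof.
by elim: u g => [|l u IH] g; rewrite /= ?add0r ?mulg1 // IH addrA mulgA.
Qed.

Lemma leval_linv l : leval (linv l) = (leval l)^-1%g.
Proof. by case: l => s [] /=; rewrite /leval /= ?invgK. Qed.

Lemma weval_winv w : weval (winv w) = (weval w)^-1%g.
Proof.
elim: w => [|l w IH]; first by rewrite invg1.
rewrite /winv /= rev_cons -cats1 weval_cat -/(winv w) IH /= mulg1 leval_linv.
by rewrite invgM.
Qed.

(** The path reading [winv w] from [g] is the reverse of the path reading [w] from
    [g * (weval w)^-1]. *)
Lemma path_val_winv c g w :
  path_val c g (winv w) = - path_val c (g * (weval w)^-1)%g w.
Proof.
elim: w g => [|l w IH] g; first by rewrite oppr0.
have -> : winv (l :: w) = winv w ++ [:: linv l].
  by rewrite /winv /= rev_cons -cats1.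
rewrite path_val_cat IH weval_winv /= addr0 invgM mulgA mulgVK.
rewrite [in RHS]addrC opprD; congr (_ + _).
case: l => s []; rewrite /letter_val /leval /= ?invgK ?mulgA ?mulgK ?opprK //.
Qed.

End EdgeCochains.

(** * The relations of the lamplighter group and its height homomorphism to the integers *)

Section Lamplighter.
Implicit Types (u v w : word lamp_gen) (g h : lamplighter).

Definition lcls w : lamplighter := pres_class lamp_rels w.
Definition lamp_a := lcls [:: (gen_a, false)].
Definition lamp_x := lcls [:: (gen_x, false)].
Local Notation a := lamp_a.
Local Notation x := lamp_x.

Lemma lcls_cat u v : lcls (u ++ v) = (lcls u * lcls v)%g.
Proof. by rewrite /lcls -pres_mulE. Qed.

Lemma lcls_nil : lcls [::] = 1%g.
Proof. by []. Qed.

Lemma lcls_winv w : lcls (winv w) = (lcls w)^-1%g.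
Proof.
apply: (@mulIg _ (lcls w)); rewrite mulVg -lcls_cat.
exact/pres_classP/pres_Vmul.
Qed.

Lemma lcls_linv l : lcls [:: linv l] = (lcls [:: l])^-1%g.
Proof. by rewrite -lcls_winv. Qed.

Lemma lcls_rel w : lamp_rels w -> lcls w = 1%g.
Proof. by move=> rw; apply/pres_classP/pres_rel. Qed.

Lemma lcls_flatten n w : lcls (flatten (nseq n w)) = (lcls w ^+ n)%g.
Proof.
by elim: n => [|n IH]; rewrite ?expg0 //= lcls_cat IH expgS.
Qed.

Lemma winv_cat u v : winv (u ++ v) = winv v ++ winv u.
Proof. by rewrite /winv map_cat rev_cat. Qed.

Lemma winv_flatten1 n (l : lamp_gen * bool) :
  winv (flatten (nseq n [:: l])) = flatten (nseq n (winv [:: l])).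
Proof.
elim: n => //= n <-; rewrite /winv /= rev_cons -cats1 /=.
elim: n => //= n IH; by rewrite rev_cons -cats1 {1}IH.
Qed.

Lemma wpowN1 (n : nat) (l : lamp_gen * bool) :
  wpow [:: l] (- n%:Z) = winv (wpow [:: l] n%:Z).
Proof. by case: n => // n; rewrite winv_flatten1. Qed.

Lemma lamp_aa : (a * a = 1)%g.
Proof. by rewrite -lcls_cat; apply: lcls_rel; left. Qed.

Lemma lamp_aV : (a^-1 = a)%g.
Proof. by apply: (@mulgI _ a); rewrite mulgV lamp_aa. Qed.

Lemma lamp_comm_conj n :
  commute a (a ^ (x ^+ n))%g.
Proof.
have : lcls (wcomm [:: (gen_a, false)] (wpow [:: (gen_x, false)] (- n%:Z) ++
   [:: (gen_a, false)] ++ wpow [:: (gen_x, false)] n%:Z)) = 1%g.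
  by apply: lcls_rel; right; exists n%:Z.
rewrite /wcomm !(lcls_cat, lcls_winv) wpowN1 lcls_winv /wpow lcls_flatten.
rewrite -/a -/x -conjgE; set z := (a ^ _)%g => E; rewrite /commute.
by apply: (mulgI z^-1%g); apply: (mulgI a^-1%g); rewrite E mulKg mulVg.
Qed.

Definition expx w : int :=
  \sum_(l <- w) (if l.1 is gen_x then (-1) ^+ l.2 else 0).

Lemma expx_cat u v : expx (u ++ v) = expx u + expx v.
Proof. by rewrite /expx big_cat. Qed.

Lemma expx_winv w : expx (winv w) = - expx w.
Proof.
rewrite /expx /winv big_rev big_map -sumrN; apply: eq_bigr => -[[] []] _ //=.
Qed.

Lemma expx_pres u v : pres_eq lamp_rels u v -> expx u = expx v.
Proof.
elim=> // {u v} [u v w _ -> _ -> //|u u' v v' _ Hu _ Hv|l|r].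
- by rewrite !expx_cat Hu Hv.
- by rewrite /expx !big_cons big_nil; case: l => [[] []].
case=> [->|[k ->]]; first by rewrite /expx !big_cons big_nil.
rewrite /wcomm !expx_cat !expx_winv [RHS]/expx big_nil !expx_cat; ring.
Qed.

(** The homomorphism to the integers with a |-> 0 and x |-> 1; it is well defined because every
    relator has exponent sum 0 in x. *)
Definition hgt g : int := expx (pres_word g).

Lemma hgt_lcls w : hgt (lcls w) = expx w.
Proof. exact/expx_pres/pres_classK. Qed.

Lemma lcls_word g : lcls (pres_word g) = g.
Proof. exact: pres_wordK. Qed.

Lemma hgtM g h : hgt (g * h)%g = hgt g + hgt h.
Proof.
by rewrite -{1}[g]lcls_word -{1}[h]lcls_word -lcls_cat hgt_lcls expx_cat.
Qed.

Lemma hgt1 : hgt 1%g = 0.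
Proof. by rewrite -lcls_nil hgt_lcls /expx big_nil. Qed.

Lemma hgtV g : hgt g^-1%g = - hgt g.
Proof. by apply/eqP; rewrite -addr_eq0 -hgtM mulVg hgt1. Qed.

Lemma hgt_a : hgt a = 0.
Proof. by rewrite hgt_lcls /expx big_cons big_nil. Qed.

Lemma hgt_x : hgt x = 1.
Proof. by rewrite hgt_lcls /expx big_cons big_nil. Qed.

Lemma hgtX g n : hgt (g ^+ n)%g = hgt g *+ n.
Proof.
by elim: n => [|n IH]; rewrite ?expg0 ?hgt1 // expgS hgtM IH mulrS.
Qed.

Lemma hgt_xX n : hgt (x ^+ n)%g = n%:Z.
Proof. by rewrite hgtX hgt_x natz. Qed.

(** For pairwise commuting involutions, the products of sublists of [s] form the subgroup that [s]
    generates; as a list it is visibly finite. *)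
Definition span_invol (s : seq lamplighter) : seq lamplighter :=
  foldr (fun t r => r ++ [seq (t * h)%g | h <- r]) [:: 1%g] s.

Lemma span_invol1 s : 1%g \in span_invol s.
Proof. by elim: s => [|t s IH]; rewrite ?inE // mem_cat IH. Qed.

Lemma span_invol_mul s t h :
  {in s &, forall g k, commute g k} -> {in s, forall g, (g * g = 1)%g} ->
  t \in s -> h \in span_invol s -> (t * h)%g \in span_invol s.
Proof.
elim: s h => // u s IH h cs s2.
have {}IH k : t \in s -> k \in span_invol s -> (t * k)%g \in span_invol s.
  move=> ts ks; apply: IH => // [v w vs ws|v vs].
    by apply: cs; rewrite inE ?vs ?ws orbT.
  by apply: s2; rewrite inE vs orbT.
rewrite inE mem_cat => /orP[/eqP->|ts] /orP[hs|/mapP[k ks ->]].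
- by rewrite /= mem_cat; apply/orP; right; apply/mapP; exists h.
- by rewrite mulgA s2 ?mem_head // mul1g /= mem_cat ks.
- by rewrite /= mem_cat IH.
- rewrite mulgA (cs t u) ?mem_head ?inE ?ts ?orbT // -mulgA /= mem_cat.
  by apply/orP; right; apply/mapP; exists (t * k)%g; rewrite ?IH.
Qed.

(** * The finite subgroup A and the derivation D attached to it *)

Section Window.
Variable n : nat.

(** The conjugate of a by x^(i - n): the shift by [n] lets natural indices 0 <= i <= 2n cover the
    exponents from -n to n. *)
Definition lamp_at i := (a ^ (x ^+ i / x ^+ n))%g.
Definition window := span_invol (map lamp_at (iota 0 n.*2.+1)).

Lemma lamp_at_sq i : (lamp_at i * lamp_at i = 1)%g.
Proof. by rewrite -conjMg lamp_aa conj1g. Qed.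

Lemma lamp_atC i j : commute (lamp_at i) (lamp_at j).
Proof.
wlog ij : i j / (i <= j)%N.
  by move=> W; case/orP: (leq_total i j) => /W // /commute_sym.
have -> : lamp_at j = ((a ^ x ^+ (j - i)) ^ (x ^+ i / x ^+ n))%g.
  by rewrite -conjgM mulgA -expgnDr subnK.
by rewrite /commute -!conjMg lamp_comm_conj.
Qed.

Lemma window1 : 1%g \in window. Proof. exact: span_invol1. Qed.

Lemma window_lamp_at i h :
  (i <= n.*2)%N -> ((lamp_at i * h)%g \in window) = (h \in window).
Proof.
move=> ni.
have H k : k \in window -> (lamp_at i * k)%g \in window.
  apply: span_invol_mul => [_ _ /mapP[p _ ->] /mapP[q _ ->]|_ /mapP[p _ ->]|].
  - exact: lamp_atC.
  - exact: lamp_at_sq.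
  - by apply: map_f; rewrite mem_iota add0n ltnS.
by apply/idP/idP => [/H|/H //]; rewrite mulgA lamp_at_sq mul1g.
Qed.

Lemma window_conj i h : (i <= n)%N ->
  (((a ^ x ^+ i) * h)%g \in window) = (h \in window).
Proof.
move=> ni; rewrite -[RHS](@window_lamp_at (i + n)) /lamp_at; last by lia.
by rewrite expgnDr mulgK.
Qed.

Lemma window_conjV i h : (i <= n)%N ->
  (((a ^ x ^- i) * h)%g \in window) = (h \in window).
Proof.
move=> ni; rewrite -[RHS](@window_lamp_at (n - i)) /lamp_at; last by lia.
by rewrite -invgF -expgnFr ?leq_subr // subKn.
Qed.

Lemma hgt_window h : h \in window -> hgt h = 0.
Proof.
rewrite /window; elim: (iota _ _) h => [|i s IH] h /=.
  by rewrite inE => /eqP ->; exact: hgt1.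
rewrite mem_cat => /orP[/IH //|/mapP[k /IH hk ->]].
rewrite hgtM hk addr0 /lamp_at; move: (_ / _)%g => y.
by rewrite /conjg !hgtM hgtV hgt_a add0r addNr.
Qed.

(** Elements of [window] have height 0, whereas x^-i x^j has height j - i. *)
Lemma window_xX (i j : nat) : ((x ^- i * x ^+ j)%g \in window) = (i == j).
Proof.
apply/idP/eqP => [/hgt_window|->]; last by rewrite mulVg window1.
by rewrite hgtM hgtV !hgt_xX; lia.
Qed.

(* [fox w h] is the coefficient at [h] of [D w] in the group ring, where
   [D (u ++ v) = D u + u (D v)], [D a = 0] and [D x] is the indicator of
   [window]; hence [D x^-1 = - x^-1 (D x)]. *)
Definition fox1 (l : lamp_gen * bool) h : int :=
  match l with
  | (gen_a, _) => 0
  | (gen_x, false) => (h \in window)%:Z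
  | (gen_x, true) => - ((x * h)%g \in window)%:Z
  end.

Fixpoint fox w h : int :=
  if w is l :: w' then fox1 l h + fox w' ((lcls [:: l])^-1 * h)%g else 0.

Lemma fox_cat u v h : fox (u ++ v) h = fox u h + fox v ((lcls u)^-1 * h)%g.
Proof.
elim: u h => [|l u IH] h; first by rewrite /= add0r lcls_nil invg1 mul1g.
by rewrite /= IH addrA (lcls_cat [:: l] u) invgM mulgA.
Qed.

Lemma fox1_linv l h : fox1 (linv l) h = - fox1 l (lcls [:: l] * h)%g.
Proof.
case: l => [[] []] /=; rewrite ?oppr0 //.
by rewrite opprK (lcls_linv (gen_x, false)) mulVKg.
Qed.

Lemma fox_winv w h : fox (winv w) h = - fox w (lcls w * h)%g.
Proof.
elim: w h => [|l w IH] h; first by rewrite oppr0.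
have fox_seq1 k g : fox [:: k] g = fox1 k g by rewrite /= addr0.
rewrite (winv_cat [:: l] w) fox_cat IH lcls_winv invgK (fox_seq1 (linv l)).
rewrite fox1_linv (lcls_cat [:: l] w) [fox (l :: w) _]/= -!mulgA mulKg.
by rewrite opprD addrC.
Qed.

Lemma fox_xX m h :
  fox (flatten (nseq m [:: (gen_x, false)])) h =
    \sum_(i < m) ((x ^- i * h)%g \in window)%:Z.
Proof.
elim: m h => [|m IH] h; first by rewrite big_ord0.
rewrite big_ord_recl /= IH invg1 mul1g; congr (_ + _).
by apply: eq_bigr => i _; rewrite expgS invgM mulgA.
Qed.

(** Let 1_A be the indicator of [window]. Left multiplication by a fixes each term x^i 1_A of
    D(x^m), since a x^i 1_A = x^i (x^-i a x^i) 1_A and i < m <= n. *)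
Lemma fox_xX_fixl m h : (m <= n)%N ->
  fox (flatten (nseq m [:: (gen_x, false)])) (a * h)%g =
  fox (flatten (nseq m [:: (gen_x, false)])) h.
Proof.
move=> mn; rewrite !fox_xX; apply: eq_bigr => i _; congr (Posz (nat_of_bool _)).
rewrite -(@window_conj i) //; last by rewrite (leq_trans (ltnW (ltn_ord i))).
by rewrite /conjg !mulgA mulgK -(mulgA _ a a) lamp_aa mulg1.
Qed.

(** Here x^m a x^-m fixes each term x^i 1_A of D(x^m), because its conjugate by x^i is x^(m-i) a
    x^-(m-i), which lies in A. *)
Lemma fox_xX_fixr m h : (m <= n)%N ->
  fox (flatten (nseq m [:: (gen_x, false)])) (x ^+ m * (a * (x ^- m * h)))%g =
  fox (flatten (nseq m [:: (gen_x, false)])) h.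
Proof.
move=> mn; rewrite !fox_xX; apply: eq_bigr => i _; congr (Posz (nat_of_bool _)).
rewrite -[RHS](@window_conjV (m - i)) //; last first.
  by rewrite (leq_trans (leq_subr _ _)).
have xm : (x ^+ m = x ^+ i * x ^+ (m - i))%g.
  by rewrite -expgnDr subnKC // ltnW.
by rewrite xm invgM /conjg invgK -!mulgA mulKg.
Qed.

(** As D(a) = 0 and D(x^-k) = - x^-k D(x^k), the value is x^-k (a - 1) D(x^k) for k >= 0 and (1 -
    x^m a x^-m) D(x^m) for k = -m. Both vanish by the two invariances above. *)
Lemma fox_conj (k : int) h : (`|k| <= n)%N ->
  let X := [:: (gen_x, false)] in
  fox (wpow X (- k) ++ [:: (gen_a, false)] ++ wpow X k) h = 0.
Proof.
move=> kn X.
have E (m : nat) : wpow X m%:Z = flatten (nseq m X) by [].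
have aE g : ((lcls [:: (gen_a, false)])^-1 * g = a * g)%g.
  by rewrite -/a lamp_aV.
rewrite !fox_cat aE /= !add0r; case: (leP 0 k) kn => [k0|/ltW k0] kn.
  have [m Em] : {m | k = Posz m} by exists `|k|%N; lia.
  move: kn; rewrite {}Em wpowN1 absz_nat E => kn.
  by rewrite fox_winv lcls_winv invgK fox_xX_fixl // addNr.
have [m Em] : {m | k = - Posz m} by exists `|k|%N; lia.
move: kn; rewrite {}Em wpowN1 opprK E fox_winv abszN absz_nat => kn.
by rewrite lcls_flatten fox_xX_fixr // addrN.
Qed.

End Window.

(** A derivation of the equality of [u] and [v] uses finitely many relators, and [fox n] kills the
    commutator with exponent k as soon as n >= |k|; N bounds the exponents used. *)
Lemma fox_pres u v : pres_eq lamp_rels u v ->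
  exists N, forall n, (N <= n)%N -> fox n u =1 fox n v.
Proof.
elim=> {u v} [u|u v _ [N H]|u v w _ [N1 H1] _ [N2 H2]|
  u u' v v' Hu [N1 H1] _ [N2 H2]|l|r].
- by exists 0.
- by exists N => n Nn h; rewrite H.
- by exists (maxn N1 N2) => n; rewrite geq_max => /andP[? ?] h; rewrite H1 // H2.
- exists (maxn N1 N2) => n; rewrite geq_max => /andP[? ?] h.
  rewrite !fox_cat H1 // H2 //; congr (_ + fox _ _ (_^-1 * _)%g).
  exact/pres_classP.
- exists 0 => n _ h; rewrite (fox_cat _ [:: l] (winv [:: l])) fox_winv mulVKg.
  by rewrite addrN.
case=> [->|[k ->]]; first by exists 0 => n _ h; rewrite /= !addr0.
exists `|k|%N => n kn h; set X := [:: (gen_x, false)].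
have := fox_conj _ kn; rewrite -/X /wcomm; move: (_ ++ _ ++ wpow X k) => u F.
by rewrite !fox_cat !fox_winv !F /= !(addr0, oppr0).
Qed.

Lemma finite_fox n w : finite_set [set h | fox n w h != 0].
Proof.
have fw : finite_set [set h | h \in window n] by exact: finite_seq.
have inj g : injective (fun h : lamplighter => (g * h)%g) by exact: mulgI.
elim: w => [|l w IH].
  by rewrite (_ : [set _ | _] = set0) // -subset0 => h /=; rewrite ?eqxx.
apply: (@sub_finite_set _ _ ([set h | fox1 n l h != 0] `|`
    (fun h => (lcls [:: l])^-1 * h)%g @^-1` [set h | fox n w h != 0])).
  move=> h /= H; case: (eqVneq (fox1 n l h) 0) => [E|]; last by left.
  by right; move: H; rewrite E add0r.
rewrite finite_setU; split; last by apply: finite_preimage => // ? ? _ _ /inj.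
case: l => [[] b].
  by rewrite (_ : [set _ | _] = set0) // -subset0 => h /=; rewrite ?eqxx.
case: b.
  apply: (@sub_finite_set _ _ ((fun h => x * h)%g @^-1` [set h | h \in window n])).
    by move=> h /=; case: (_ \in _).
  by apply: finite_preimage => // ? ? _ _ /inj.
by apply: sub_finite_set fw => h /=; case: (_ \in _).
Qed.

(** * The cochains c_y for a finite set S of group elements *)

Section Generators.
Variable S : {fset lamplighter}.

Definition letter_word (l : S * bool) : word lamp_gen :=
  if l.2 then winv (pres_word (val l.1)) else pres_word (val l.1).

Definition lift_word (w : word S) : word lamp_gen := flatten (map letter_word w).

Lemma lcls_letter_word l : lcls (letter_word l) = leval l.
Proof.
by rewrite /letter_word /leval; case: l.2; rewrite ?lcls_winv lcls_word.
Qed.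

Lemma lcls_lift_word (w : word S) : lcls (lift_word w) = weval w :> lamplighter.
Proof. by elim: w => //= l w IH; rewrite lcls_cat IH lcls_letter_word. Qed.

(** The coefficient at [y] of g D(s), with [s] spelled as a word in a and x. *)
Definition fox_cochain n (y g : lamplighter) (s : S) : int :=
  fox n (pres_word (val s)) (g^-1 * y)%g.

(** Summing along the path unfolds the product rule of D, which yields the coefficient at [y] of g
    D(w). *)
Lemma path_val_fox n y g (w : word S) :
  path_val (fox_cochain n y) g w = fox n (lift_word w) (g^-1 * y)%g.
Proof.
elim: w g => //= l w IH g.
rewrite IH fox_cat lcls_letter_word invgM mulgA; congr (_ + _).
rewrite /letter_word /letter_val /fox_cochain; case: l.2 => //.
by rewrite fox_winv lcls_word invgM invgK mulgA.
Qed.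

Lemma finite_support_fox_cochain n y :
  finite_set [set g | exists s, fox_cochain n y g s != 0].
Proof.
rewrite (_ : [set _ | _] = \bigcup_(s in [set: S])
    (fun g => g^-1 * y)%g @^-1` [set h | fox n (pres_word (val s)) h != 0]).
  apply: bigcup_finite => [|s _]; first exact: finite_finset.
  apply: (@finite_preimage _ _ _ (fun g => g^-1 * y)%g); last exact: finite_fox.
  by move=> g g' _ _ /mulIg /invg_inj.
by apply/seteqP; split => g [s]; [exists s|move=> _ ?; exists s].
Qed.

(** D(s) has finite support, and the elements g^-1 x^j are pairwise distinct because their heights
    are. *)
Lemma fox_cochain_eventually0 n g s :
  exists J, forall j, (J <= j)%N -> fox_cochain n (lamp_x ^+ j)%g g s = 0.
Proof.
have : finite_set [set j : nat |
    fox n (pres_word (val s)) (g^-1 * lamp_x ^+ j)%g != 0].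
  apply: (@finite_preimage _ _ [set h | fox n (pres_word (val s)) h != 0]
    (fun j : nat => g^-1 * lamp_x ^+ j)%g).
    by move=> i j _ _ /mulgI /(congr1 hgt); rewrite !hgt_xX => -[].
  exact: finite_fox.
move=> /finite_seqP[t /seteqP[st _]]; exists (\max_(i <- t) i).+1 => j tj.
apply/eqP; apply: contraTT tj => /st /= jt.
by rewrite -leqNgt leq_bigmax_seq.
Qed.

(** The copy of [w] leading from x^i to x^(i+1) contributes x^i 1_A, and x^j lies in x^i A only for
    i = j. *)
Lemma path_val_fox_power n (w : word S) p k j :
  fox n (lift_word w) =1 fox n [:: (gen_x, false)] -> weval w = lamp_x ->
  path_val (fox_cochain n (lamp_x ^+ j)%g) (lamp_x ^+ p)%g (flatten (nseq k w)) =
  ((p <= j) && (j < p + k))%N%:Z.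
Proof.
move=> Hw wx; elim: k p => [|k IH] p; first by rewrite /= addn0 leqNgt andNb.
rewrite /= path_val_cat wx -expgSr IH path_val_fox Hw /= addr0 window_xX.
by lia.
Qed.

(** The inverse copies of [w] contribute only terms - x^i 1_A with i < 0, whose supports miss x^j
    for j >= 0. *)
Lemma path_val_fox_powerV n (w : word S) p k j :
  fox n (lift_word w) =1 fox n [:: (gen_x, false)] -> weval w = lamp_x ->
  path_val (fox_cochain n (lamp_x ^+ j)%g) (lamp_x ^- p)%g
    (flatten (nseq k (winv w))) = 0.
Proof.
move=> Hw wx; elim: k p => [//|k IH] p.
rewrite /= path_val_cat weval_winv wx -invgM -expgS IH path_val_winv wx.
rewrite -invgM -expgS path_val_fox Hw /= addr0 invgK -expgnDr.
by have := window_xX n 0 (p.+1 + j); rewrite expg0 invg1 mul1g => ->.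
Qed.

End Generators.

(** * Periodic words, and the choice of n for a finite set of relators *)

Lemma nat_periodic_unbounded (f : nat -> int) len : (0 < len)%N ->
  (forall n, f (len + n)%N = f n + 1) ->
  forall M, exists N, forall n, (N <= n)%N -> M <= f n.
Proof.
move=> len0 fS M.
have [B HB] : exists B, forall n, (n < len)%N -> B <= f n.
  elim: len {len0 fS} => [|k [B HB]]; first by exists 0.
  exists (Order.min B (f k)) => n; rewrite ltnS leq_eqVlt ge_min.
  by move=> /orP[/eqP->|/HB ->]; rewrite ?lexx ?orbT.
have fM m q : f (m * len + q)%N = f q + m%:Z.
  elim: m => [|m IH]; first by rewrite addr0.
  by rewrite mulSn -addnA fS IH -addrA -addn1 PoszD.
exists (`|M - B| * len)%N => n; rewrite -leq_divRL // => Hn.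
by rewrite (divn_eq n len) fM; have := HB _ (ltn_pmod n len0); lia.
Qed.

(** The letters of the infinite power of [s]; the default [t0] is reached only when [s] is empty. *)
Definition cycle_nth (T : Type) (t0 : T) (s : seq T) (n : nat) : T :=
  nth t0 s (n %% size s).

Lemma cycle_nthS T (t0 : T) s n :
  (0 < size s)%N -> mkseq (cycle_nth t0 s) (size s + n) = s ++ mkseq (cycle_nth t0 s) n.
Proof.
move=> s0; rewrite /mkseq iotaD map_cat add0n; congr (_ ++ _).
  apply: (@eq_from_nth _ t0); rewrite size_map size_iota // => i il.
  by rewrite (nth_map 0) ?size_iota // nth_iota // /cycle_nth modn_small.
rewrite -[X in iota X]addn0 iotaDl -map_comp; apply: eq_map => i /=.
by rewrite /cycle_nth modnDl.
Qed.

Lemma cycle_nthM T (t0 : T) s m : (0 < size s)%N ->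
  mkseq (cycle_nth t0 s) (m * size s) = flatten (nseq m s).
Proof. by move=> s0; elim: m => //= m IH; rewrite mulSn cycle_nthS // IH. Qed.

(** The sign [e] covers both rays: e = 1 when [w] spells x, and e = -1 when it spells x^-1. *)
Lemma hgt_cycle_nth_unbounded (S : {fset lamplighter}) (w : word S) l0 (e : int) :
  (0 < size w)%N -> e * hgt (weval w) = 1 ->
  forall M, exists N, forall n, (N <= n)%N ->
    M <= e * hgt (weval (mkseq (cycle_nth l0 w) n)).
Proof.
move=> w0 hw; apply: (nat_periodic_unbounded w0) => n.
by rewrite cycle_nthS // weval_cat hgtM mulrDr hw addrC.
Qed.

(** Each relator, and the equality of [w] with x, holds for D beyond some threshold by [fox_pres];
    there are finitely many thresholds, and n is their maximum. *)
Lemma fox_relators (S : {fset lamplighter}) (rels : {fset free_group S}) (w : word S) :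
  (forall r, r \in rels -> phi r = 1%g) -> weval w = lamp_x ->
  exists n, fox n (lift_word w) =1 fox n [:: (gen_x, false)] /\
    forall y g (r : rels), path_val (fox_cochain n y) g (val (val r)) = 0.
Proof.
move=> relP wx.
have [N0 HN0] : exists N, forall n, (N <= n)%N ->
    fox n (lift_word w) =1 fox n [:: (gen_x, false)].
  by apply: fox_pres; apply/pres_classP; rewrite -/(lcls _) lcls_lift_word.
have [N HN] : exists N, forall r, r \in enum_fset rels -> forall n, (N <= n)%N ->
    fox n (lift_word (val r)) =1 fox n [::].
  have : {subset enum_fset rels <= rels} by [].
  elim: (enum_fset rels) => [|r s IH] rsub; first by exists 0.
  have [|N1 H1] := IH; first by move=> u us; apply: rsub; rewrite inE us orbT.
  have [N2 H2] : exists N, forall n, (N <= n)%N ->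
      fox n (lift_word (val r)) =1 fox n [::].
    apply: fox_pres; apply/pres_classP; rewrite -/(lcls _) lcls_lift_word.
    exact/relP/rsub/mem_head.
  exists (maxn N1 N2) => u; rewrite inE => /orP[/eqP->|us] n;
    rewrite geq_max => /andP[? ?].
    exact: H2.
  exact: H1.
exists (maxn N0 N); split; first by apply: HN0; exact: leq_maxl.
move=> y g r; rewrite path_val_fox HN ?leq_maxr //; exact: valP.
Qed.

End Lamplighter.

(** * Lifting maps from a rectangle to the circle *)

Lemma continuous_pair (T U V : topologicalType) (f : T -> U) (g : T -> V) (x : T) :
  {for x, continuous f} -> {for x, continuous g} ->
  {for x, continuous (fun t => (f t, g t))}.
Proof.
move=> cf cg; exact: (@cvg_pair _ _ _ (nbhs x) (nbhs (f x)) (nbhs (g x))).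
Qed.

Section Circle.
Variable R : realType.
Implicit Types (f : R -> R) (p q : R * R).

Lemma cos1_sin0 (x : R) : cos x = 1 -> sin x = 0.
Proof.
by move=> c1; apply/eqP; rewrite -sqrf_eq0 sin2cos2 c1 expr1n subrr.
Qed.

(** Both end values are multiples of 2 pi. If they were distinct, they would be more than pi apart,
    and [f] would pass through a value at distance pi from [f a], where the cosine is -1. *)
Lemma arc_endpoints_eq f a b : a <= b -> {within `[a, b], continuous f} ->
  (forall t, t \in `[a, b] -> 0 < cos (f t)) ->
  cos (f a) = 1 -> cos (f b) = 1 -> f a = f b.
Proof.
move=> ab fc fpos ca cb.
have pi0 := @pi_gt0 R.
have sa := cos1_sin0 ca.
have key (d : R) : 0 <= d -> (f b = f a + d \/ f b = f a - d) -> d = 0.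
  move=> d0 E; case: (leP d pi) => [dpi|dpi].
    have cd : cos d = 1.
      by rewrite -cb; case: E => ->; rewrite cosD ca ?cosN ?sinN sa; ring.
    by apply: cos_inj; rewrite ?cos0 // in_itv /= ?d0 ?lexx ?dpi ?ltW.
  pose v := if f a <= f b then f a + pi else f a - pi.
  have vb : Num.min (f a) (f b) <= v <= Num.max (f a) (f b).
    by rewrite /v; case: E => ->; case: ifP => ?;
      rewrite ge_min le_max; apply/andP; split; apply/orP; lra.
  have [c cab fcv] := IVT ab fc vb.
  exfalso; have := fpos c cab; rewrite fcv /v.
  by case: ifP => _; rewrite cosD ?cosN ?sinN cospi sinpi ca sa => ?; lra.
apply/esym/eqP; rewrite -subr_eq0 -normr_eq0; apply/eqP/key => //.
by case: (ger0P (f b - f a)) => _; [left|right]; ring.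
Qed.

Lemma cos_sin_atan_div (c d : R) : 0 < d -> d ^+ 2 + c ^+ 2 = 1 ->
  cos (atan (c / d)) = d /\ sin (atan (c / d)) = c.
Proof.
move=> d0 cd; have dn0 : d != 0 by rewrite gt_eqF.
have Ec : cos (atan (c / d)) = d.
  rewrite cos_atan (_ : 1 + _ = (d^-1) ^+ 2); last first.
    apply: (mulIf (expf_neq0 2 dn0)).
    by rewrite expr_div_n exprVn mulrDl divfK ?mulVf ?expf_neq0 // mul1r.
  by rewrite sqrtr_sqr gtr0_norm ?invr_gt0 // invrK.
split=> //; have := atanK (c / d); rewrite /tan Ec => /(congr1 ( *%R^~ d)).
by rewrite !divfK.
Qed.


(** A form of uniform continuity of the unit vector (U, V) on the compact rectangle: the
    displacement p / (N + 1) is small uniformly in [p]. *)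
Lemma unit_near_dot (U V : R * R -> R) (T : R) :
  continuous U -> continuous V -> (forall p, U p ^+ 2 + V p ^+ 2 = 1) ->
  exists N : nat, forall p q, 0 <= p.1 <= T -> 0 <= p.2 <= 1 ->
    0 <= q.1 <= T -> 0 <= q.2 <= 1 ->
    let q' := (q.1 + p.1 / N.+1%:R, q.2 + p.2 / N.+1%:R) in
    0 < U q * U q' + V q * V q'.
Proof.
move=> cU cV UV.
pose K : set (R * R) := `[0, T] `*` `[0, 1].
have cK : compact K by apply: compact_setX; exact: segment_compact.
have := (compact_near_coveringP K).1 cK nat \oo (fun n q => forall p, K p ->
  let q' := (q.1 + p.1 / n.+1%:R, q.2 + p.2 / n.+1%:R) in
  0 < U q * U q' + V q * V q').
case.
  move=> q Kq.
  (* The inner product as a function of base point and displacement; it is 1 at displacement 0,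
     hence positive nearby. *)
  pose g (u : (R * R) * (R * R)) :=
    let q' := (u.1.1 + u.2.1, u.1.2 + u.2.2) in U u.1 * U q' + V u.1 * V q'.
  have cg : {for (q, (0, 0)), continuous g}.
    have c1 (T' U' V' : topologicalType) (f : T' -> U' * V') t :
        {for t, continuous f} -> {for t, continuous (fst \o f)}.
      by move=> cf; apply: continuous_comp => //; exact: cvg_fst.
    have c2 (T' U' V' : topologicalType) (f : T' -> U' * V') t :
        {for t, continuous f} -> {for t, continuous (snd \o f)}.
      by move=> cf; apply: continuous_comp => //; exact: cvg_snd.
    have cq : {for (q, (0, 0)), continuous
        (fun u : (R * R) * (R * R) => (u.1.1 + u.2.1, u.1.2 + u.2.2))}.
      apply: continuous_pair; apply: cvgD.
      - by apply: (c1 _ _ _ fst); exact: cvg_fst.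
      - by apply: (c1 _ _ _ snd); exact: cvg_snd.
      - by apply: (c2 _ _ _ fst); exact: cvg_fst.
      - by apply: (c2 _ _ _ snd); exact: cvg_snd.
    apply: cvgD; apply: cvgM; apply: continuous_comp => //.
    - by exact: cvg_fst.
    - exact: cU.
    - exact: cU.
    - by exact: cvg_fst.
    - exact: cV.
    - exact: cV.
  have g0 : 0 < g (q, (0, 0)).
    by rewrite /g /= !addr0 -surjective_pairing -!expr2 UV.
  have : \forall u \near (q, (0, 0) : R * R), 0 < g u by exact: (cvgr_gt _ cg).
  case=> -[A B] /= [nA /nbhs_ballP[e /= e0 Be]] AB.
  exists (A, [set n : nat | Num.max T 1 / n.+1%:R < e]).
    split=> //=; exists (Num.truncn (Num.max T 1 / e)) => // n /= Hn.
    rewrite ltr_pdivrMr // mulrC -ltr_pdivrMr //.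
    apply: (lt_le_trans (truncnS_gt _)).
    by rewrite ler_nat ltnS.
  case=> q' n /= [Aq' ne] p [/=]; rewrite !in_itv /= => /andP[p10 p1T] /andP[p20 p21].
  have := AB (q', (p.1 / n.+1%:R, p.2 / n.+1%:R)); apply; split=> //=; apply: Be.
  have lt1 y : 0 <= y <= Num.max T 1 -> ball 0 e (y / n.+1%:R).
    move=> /andP[y0 yT]; rewrite -ball_normE /= sub0r normrN ger0_norm.
      by apply: le_lt_trans ne; rewrite ler_pM2r ?invr_gt0.
    by rewrite divr_ge0.
  by split=> /=; apply: lt1; rewrite le_max ?p10 ?p1T ?p20 ?p21 ?orbT.
move=> N _ /(_ N (leqnn N)) H; exists N => p q p1 p2 q1 q2.
by apply: (H q _ p); split; rewrite /= in_itv.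
Qed.

(* The angle at [p] is the sum of the small angles between the values at
   [p i / N] and [p (i + 1) / N], each of which is an arctangent. *)
Lemma circle_lift (U V : R * R -> R) (T : R) :
  continuous U -> continuous V -> (forall p, U p ^+ 2 + V p ^+ 2 = 1) ->
  U (0, 0) = 1 -> 0 <= T ->
  exists L : R * R -> R, forall p, 0 <= p.1 <= T -> 0 <= p.2 <= 1 ->
    [/\ {for p, continuous L}, cos (L p) = U p & sin (L p) = V p].
Proof.
move=> cU cV UV U0 T0.
have [N HN] := unit_near_dot T cU cV UV.
pose z (i : nat) (p : R * R) := (i%:R / N.+1%:R * p.1, i%:R / N.+1%:R * p.2).
(* With (U, V) read as a complex number of modulus 1, [dot] and [cross] are the real and imaginary
   parts of the quotient of consecutive values. *)
pose dot i p := U (z i p) * U (z i.+1 p) + V (z i p) * V (z i.+1 p).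
pose cross i p := U (z i p) * V (z i.+1 p) - V (z i p) * U (z i.+1 p).
exists (fun p => \sum_(i < N.+1) atan (cross i p / dot i p)) => p p1 p2.
have dot0 i : (i < N.+1)%N -> 0 < dot i p.
  move=> iN.
  have b (y M : R) : 0 <= y <= M -> 0 <= i%:R / N.+1%:R * y <= M.
    move=> /andP[y0 yM]; rewrite mulr_ge0 ?divr_ge0 //=.
    apply: le_trans yM; rewrite -[leRHS]mul1r ler_wpM2r //.
    by rewrite ler_pdivrMr // mul1r ler_nat ltnW.
  have := HN p (z i p) p1 p2 (b _ _ p1) (b _ _ p2).
  have e (y : R) : i%:R / N.+1%:R * y + y / N.+1%:R = i.+1%:R / N.+1%:R * y.
    by rewrite -(natr1 i); ring.
  by rewrite /= !e.
have cz i : {for p, continuous (z i)}.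
  by apply: continuous_pair; apply: cvgM; [exact: cvg_cst|exact: cvg_fst
    |exact: cvg_cst|exact: cvg_snd].
have part k : (k <= N.+1)%N ->
    cos (\sum_(i < k) atan (cross i p / dot i p)) = U (z k p) /\
    sin (\sum_(i < k) atan (cross i p / dot i p)) = V (z k p).
  elim: k => [|k IH] kN.
    have z0 : z 0 p = (0, 0) by rewrite /z !mul0r.
    rewrite big_ord0 cos0 sin0 z0 U0; split=> //; apply/esym/eqP.
    by rewrite -sqrf_eq0; have := UV (0, 0); rewrite U0 => ?; apply/eqP; lra.
  have [IHc IHs] := IH (ltnW kN).
  have [] := @cos_sin_atan_div (cross k p) (dot k p) (dot0 _ kN).
    rewrite /cross /dot; have := UV (z k p); have := UV (z k.+1 p).
    set u := U _; set v := V _; set u' := U _; set v' := V _ => E1 E2.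
    by rewrite -[RHS]mulr1 -{1}E1 -E2; ring.
  rewrite big_ord_recr /= cosD sinD IHc IHs => -> ->; rewrite /dot /cross.
  have := UV (z k p); set u := U (z k p); set v := V (z k p) => E2.
  split; rewrite -[RHS]mul1r -E2; ring.
have zN : z N.+1 p = p by rewrite /z divff ?pnatr_eq0 // !mul1r -surjective_pairing.
have [pc ps] := part _ (leqnn _); rewrite zN in pc ps; split=> //.
have ccomp (W : R * R -> R) i : continuous W ->
    {for p, continuous (fun p => W (z i p))}.
  by move=> cW; apply: (@continuous_comp _ _ _ (z i) W) => //; exact: cW.
have cterm i : (i < N.+1)%N ->
    {for p, continuous (fun p => atan (cross i p / dot i p))}.
  move=> iN; apply: (@continuous_comp _ _ _ (fun p => cross i p / dot i p) atan).
    apply: cvgM; first by apply: cvgB; apply: cvgM; exact: ccomp.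
    apply: cvgV; first by rewrite gt_eqF ?dot0.
    by apply: cvgD; apply: cvgM; exact: ccomp.
  exact: continuous_atan.
suff csum k : (k <= N.+1)%N ->
    {for p, continuous (fun p => \sum_(i < k) atan (cross i p / dot i p))}.
  exact: csum.
elim: k => [_|k IH kN].
  have -> : (fun p => \sum_(i < 0) atan (cross i p / dot i p)) = (fun=> 0).
    by apply/funext => ?; rewrite big_ord0.
  exact: cvg_cst.
have -> : (fun p => \sum_(i < k.+1) atan (cross i p / dot i p)) =
    (fun p => \sum_(i < k) atan (cross i p / dot i p) + atan (cross k p / dot k p)).
  by apply/funext => ?; rewrite big_ord_recr.
by apply: cvgD; [exact: (IH (ltnW kN))|exact: cterm].
Qed.

(** [A0] and [A1] are angle functions on the horizontal sides, so a lift [L] over the rectangle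
    differs from each by a constant. On the vertical sides the cosine is positive, so [L] has equal
    values at their two ends. *)
Lemma circle_square (U V : R * R -> R) (T : R) (A0 A1 : R -> R) :
  continuous U -> continuous V -> (forall p, U p ^+ 2 + V p ^+ 2 = 1) ->
  0 <= T -> continuous A0 -> continuous A1 ->
  (forall t, 0 <= t <= T -> U (t, 0) = cos (A0 t) /\ V (t, 0) = sin (A0 t)) ->
  (forall t, 0 <= t <= T -> U (t, 1) = cos (A1 t) /\ V (t, 1) = sin (A1 t)) ->
  (forall s, 0 <= s <= 1 -> 0 < U (0, s) /\ 0 < U (T, s)) ->
  [/\ U (0, 0) = 1, U (0, 1) = 1, U (T, 0) = 1 & U (T, 1) = 1] ->
  A0 T - A0 0 = A1 T - A1 0.
Proof.
move=> cU cV UV T0 cA0 cA1 bot top sides [U00 U01 UT0 UT1].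
have [L HL] := circle_lift cU cV UV U00 T0.
have hor (s : R) (A : R -> R) : 0 <= s <= 1 -> continuous A ->
    (forall t, 0 <= t <= T -> U (t, s) = cos (A t) /\ V (t, s) = sin (A t)) ->
    L (0, s) - A 0 = L (T, s) - A T.
  move=> s01 cA HA.
  have c1 t : 0 <= t <= T -> cos (L (t, s) - A t) = 1.
    move=> tT; have [_ cL sL] := HL (t, s) tT s01; have [Ut Vt] := HA _ tT.
    by rewrite cosB cL sL Ut Vt -!expr2 cos2Dsin2.
  apply: (@arc_endpoints_eq (fun t => L (t, s) - A t)) => //.
  - apply: continuous_in_subspaceT => t; rewrite inE /= in_itv /= => tT.
    have [cL _ _] := HL (t, s) tT s01.
    apply: cvgB; last exact: cA.
    apply: (@cvg_comp _ _ _ (fun t : R => (t, s)) L _ (nbhs (t, s))) => //.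
    by apply: (@continuous_pair _ _ _ id (fun=> s)); [exact: cvg_id|exact: cvg_cst].
  - by move=> t; rewrite in_itv => /c1 ->.
  - by rewrite c1 ?lexx.
  - by rewrite c1 ?lexx ?T0.
have ver (t : R) : 0 <= t <= T -> (forall s, 0 <= s <= 1 -> 0 < U (t, s)) ->
    U (t, 0) = 1 -> U (t, 1) = 1 -> L (t, 0) = L (t, 1).
  move=> tT Upos U0 U1; apply: (@arc_endpoints_eq (fun s => L (t, s))) => //.
  - apply: continuous_in_subspaceT => s; rewrite inE /= in_itv /= => s01.
    have [cL _ _] := HL (t, s) tT s01.
    apply: (@cvg_comp _ _ _ (fun s : R => (t, s)) L _ (nbhs (t, s))) => //.
    by apply: (@continuous_pair _ _ _ (fun=> t) id); [exact: cvg_cst|exact: cvg_id].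
  - by move=> s; rewrite in_itv => s01; have [_ -> _] := HL (t, s) tT s01; exact: Upos.
  - by have [_ ->] := HL (t, 0) tT (introT andP (conj (lexx 0) ler01)).
  - by have [_ ->] := HL (t, 1) tT (introT andP (conj ler01 (lexx 1))).
have h0 := hor 0 A0 (introT andP (conj (lexx 0) ler01)) cA0 bot.
have h1 := hor 1 A1 (introT andP (conj ler01 (lexx 1))) cA1 top.
have v0 := ver 0 (introT andP (conj (lexx 0) T0)) (fun s h => (sides s h).1) U00 U01.
have vT := ver T (introT andP (conj T0 (lexx T))) (fun s h => (sides s h).2) UT0 UT1.
lra.
Qed.

End Circle.

(** * Clamping to an interval, and extension of functions from the circle to the disc *)

Lemma continuous_within_comp (T U V : topologicalType) (A : set U)
    (f : U -> V) (c : T -> U) :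
  {within A, continuous f} -> continuous c -> (forall t, A (c t)) ->
  continuous (f \o c).
Proof.
move=> /subspace_continuousP cf cc cA t W /(cf _ (cA t)) /= H.
have : \forall y \near t, A (c y) -> W (f (c y)) by exact: cc _ H.
by apply: filterS => y; apply.
Qed.

Section Disc.
Variable R : realType.
Implicit Types (p : R * R).

(** For a <= b, the retraction of the line onto [a, b]; composing with it turns continuity within
    [a, b] into continuity everywhere. *)
Definition clamp (a b t : R) : R := Num.max a (Num.min b t).

Lemma continuous_clamp a b : continuous (clamp a b).
Proof.
move=> t; apply: continuous_max; first exact: cvg_cst.
by apply: continuous_min; [exact: cvg_cst|exact: cvg_id].
Qed.

Lemma clamp_id a b t : a <= t <= b -> clamp a b t = t.
Proof. by move=> /andP[at_ tb]; rewrite /clamp min_r // max_r. Qed.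

Lemma clamp_itv a b t : a <= b -> a <= clamp a b t <= b.
Proof.
by move=> ab; rewrite /clamp le_max lexx ge_max ab ge_min lexx.
Qed.

Lemma clamp_le a b t : t <= a -> a <= b -> clamp a b t = a.
Proof.
by move=> ta ab; rewrite /clamp max_l // ge_min ta orbT.
Qed.

Lemma clamp_ge a b t : b <= t -> a <= b -> clamp a b t = b.
Proof. by move=> bt ab; rewrite /clamp min_l // max_r. Qed.

Lemma continuous_acos_clamp : continuous (fun t : R => acos (clamp (-1) 1 t)).
Proof.
apply: (@continuous_within_comp R R R (`[(-1), 1] : set R) (@acos R) (clamp (-1) 1)).
- have := @segment_can_ge_continuous R 0 pi (@cos R) (@acos R) (pi_ge0 R).
  rewrite cospi cos0; apply; last exact: cosK.
  exact/continuous_subspaceT/continuous_cos.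
- exact: continuous_clamp.
- by move=> t; rewrite /= in_itv; apply: clamp_itv; lra.
Qed.

Definition circle : set (R * R) := [set p | p.1 ^+ 2 + p.2 ^+ 2 = 1].

Lemma circle_fst p : circle p -> -1 <= p.1 <= 1.
Proof. by rewrite /circle /= => p1; apply/andP; nra. Qed.

Lemma turn_itv p : circle p -> 0 <= turn p <= 1.
Proof.
move=> /circle_fst p1; have a0 := acos_ge0 p1; have a1 := acos_lepi p1.
have pi0 := @pi_gt0 R; have pi20 : 0 < 2 * pi :> R by lra.
have q0 : 0 <= acos p.1 / (2 * pi) by rewrite divr_ge0 // ltW.
have q1 : acos p.1 / (2 * pi) <= 1 by rewrite ler_pdivrMr // mul1r; lra.
by rewrite /turn; case: ifP => _; apply/andP; lra.
Qed.

Lemma closed_circle : closed circle.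
Proof.
have c : continuous (fun p => p.1 ^+ 2 + p.2 ^+ 2 : R).
  by move=> p; apply: cvgD; apply: cvgM; (exact: cvg_fst || exact: cvg_snd).
rewrite (_ : circle = (fun p => p.1 ^+ 2 + p.2 ^+ 2) @^-1` [set 1]) //.
by apply: closed_comp => // p _; exact: c.
Qed.

(** [turn] jumps from 1 to 0 at (1, 0), where phi 0 = phi n closes the gap. The function is glued
    from the closed upper and lower half circles. *)
Lemma continuous_circle_turn (phi : R -> R) (n : R) :
  continuous phi -> phi 0 = phi n ->
  {within circle, continuous (fun p => phi (n * turn p))}.
Proof.
move=> cphi phi0n.
have pin0 : (pi : R) != 0 by rewrite gt_eqF ?pi_gt0.
pose A p := acos (clamp (-1) 1 p.1) / (2 * pi).
have cA : continuous A.
  move=> p; apply: cvgM; last exact: cvg_cst.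
  apply: (@continuous_comp _ _ _ fst (fun t : R => acos (clamp (-1) 1 t))).
    exact: cvg_fst.
  exact: continuous_acos_clamp.
have cl (f : R * R -> R) : continuous f -> closed [set p | 0 <= f p].
  move=> cf; rewrite (_ : [set _ | _] = f @^-1` [set t | 0 <= t]) //.
  by apply: closed_comp => // p _; exact: cf.
rewrite (_ : circle = (circle `&` [set p | 0 <= p.2]) `|`
    (circle `&` [set p | 0 <= - p.2])); last first.
  rewrite -setIUr; apply/seteqP; split => p; last by case.
  by move=> cp; split=> //=; rewrite oppr_ge0; apply/orP/le_total.
apply: withinU_continuous.
- apply: closedI; [exact: closed_circle|apply: cl => p; exact: cvg_snd].
- apply: closedI; [exact: closed_circle|apply: cl => p].
  by apply: cvgN; exact: cvg_snd.
- apply: (@subspace_eq_continuous _ _ _ (fun p => phi (n * A p))).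
    move=> p; rewrite inE => -[/circle_fst p1 /= p2].
    change (phi (n * A p) = phi (n * turn p)).
    by rewrite /turn ifT // /A clamp_id.
  apply: continuous_subspaceT => p.
  apply: (@continuous_comp _ _ _ (fun p => n * A p) phi); last exact: cphi.
  by apply: cvgM; [exact: cvg_cst|exact: cA].
- apply: (@subspace_eq_continuous _ _ _ (fun p => phi (n * (1 - A p)))).
    move=> p; rewrite inE => -[cp /= p2]; have p1 := circle_fst cp.
    change (phi (n * (1 - A p)) = phi (n * turn p)).
    rewrite /turn /A clamp_id //; case: ifP => // p2'.
    (* The half circles meet in two points. At (1, 0) the two formulas give phi n and phi 0; at (-1,
       0) both formulas for [turn] give 1/2. *)
    have p20 : p.2 = 0 by lra.
    have /eqP : (p.1 - 1) * (p.1 + 1) = 0 :> R.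
      by move: cp; rewrite /circle /= p20 => ?; lra.
    rewrite mulf_eq0 => /orP[] /eqP E.
      have -> : p.1 = 1 by lra.
      by rewrite acos1 mul0r subr0 mulr1 mulr0.
    have -> : p.1 = -1 by lra.
    have h : pi / (2 * pi) = 2^-1 :> R by rewrite invfM mulrCA divff // mulr1.
    have e : 1 - 2^-1 = 2^-1 :> R by lra.
    by rewrite acosN1 h e.
  apply: continuous_subspaceT => p.
  apply: (@continuous_comp _ _ _ (fun p => n * (1 - A p)) phi); last exact: cphi.
  by apply: cvgM; [exact: cvg_cst|apply: cvgB; [exact: cvg_cst|exact: cA]].
Qed.

(** Tietze extension from the closed circle. The zero function is treated apart, so that its
    extension vanishes on the whole disc. *)
Lemma disc_extension (phi : R -> R) (n : R) :
  0 <= n -> continuous phi -> phi 0 = phi n ->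
  exists E : R * R -> R, [/\ continuous E,
    forall p, circle p -> E p = phi (n * turn p) &
    (forall t, phi t = 0) -> forall p, E p = 0].
Proof.
move=> n0 cphi phi0n.
have [phi0|nphi0] := pselect (forall t, phi t = 0).
  by exists (fun=> 0); split=> // p; exact: cvg_cst.
have [c _ Hc] : exists2 c, c \in `[0, n] &
    forall t, t \in `[0, n] -> `|phi t| <= `|phi c|.
  apply: EVT_max => //; apply: continuous_subspaceT => t.
  apply: (@continuous_comp _ _ _ phi (fun y : R => `|y|)); first exact: cphi.
  exact: norm_continuous.
have [|//||E [EP cE _]] := @continuous_bounded_extension _ R
  (@pseudometric_normal R _) _ closed_circle (fun p => phi (n * turn p)) (`|phi c| + 1).
- by rewrite ltr_wpDl.
- exact: continuous_circle_turn.
- move=> p cp; rewrite ler_wpDr // Hc // in_itv /=.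
  have /andP[t0 t1] := turn_itv cp.
  by rewrite mulr_ge0 //= -[leRHS]mulr1 ler_wpM2l.
- exists E; split=> // p cp; by rewrite EP // inE.
Qed.

End Disc.

(** * Maps defined cell by cell *)

Lemma continuous_if_le (R : realType) (T : topologicalType) (f g : R -> T) (c : R) :
  continuous f -> continuous g -> f c = g c ->
  continuous (fun t => if t <= c then f t else g t).
Proof.
move=> cf cg fgc; apply/continuous_subspace_setT.
rewrite (_ : setT = [set t | t <= c] `|` [set t | c <= t]); last first.
  by apply/seteqP; split => t //= _; apply/orP/le_total.
apply: withinU_continuous; [exact: closed_le|exact: closed_ge| |].
- apply: (@subspace_eq_continuous _ _ _ f); last exact: continuous_subspaceT.
  by move=> t; rewrite inE /= => tc; rewrite /from_subspace tc.
- apply: (@subspace_eq_continuous _ _ _ g); last exact: continuous_subspaceT.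
  move=> t; rewrite inE /= => tc; rewrite /from_subspace; case: ifP => // ct.
  by have -> : t = c by apply/le_anti; rewrite tc ct.
Qed.

Section Complex.
Variables (R : realType) (G : groupType) (S : {fset G}) (rels : {fset free_group S}).
Local Notation X := (cayley_complex R rels).
Implicit Types (g : G) (s : S) (l : S * bool) (w : word S) (t : R).

Lemma edge_map_le0 g s t : t <= 0 -> edge_map rels g s t = CV R rels g.
Proof.
by move=> t0; rewrite /edge_map insubF ?t0 // ltNge t0.
Qed.

Lemma edge_map_ge1 g s t : 1 <= t -> edge_map rels g s t = CV R rels (g * val s)%g.
Proof.
move=> t1; rewrite /edge_map insubF; last by rewrite andbC ltNge t1.
by rewrite leNgt (lt_le_trans ltr01 t1).
Qed.

Lemma edge_map_CE g s (u : {t : R | 0 < t < 1}) :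
  edge_map rels g s (val u) = CE rels g s u.
Proof. by rewrite /edge_map valK. Qed.

Lemma edge_map_clamp g s t : edge_map rels g s (clamp 0 1 t) = edge_map rels g s t.
Proof.
have [t0|t0] := leP t 0; first by rewrite clamp_le // !edge_map_le0.
have [t1|t1] := leP 1 t; first by rewrite clamp_ge // !edge_map_ge1.
by rewrite clamp_id // !ltW.
Qed.

Lemma cw_open (U : set X) :
  (forall g s, open ((edge_map rels g s @^-1` U) : set (subspace (`[0, 1] : set R)))) ->
  (forall g (r : rels),
     open ((disc_map g r @^-1` U) : set (subspace (@unit_disc R)))) ->
  open U.
Proof. by []. Qed.

Lemma cw_continuous (T : topologicalType) (f : X -> T) :
  (forall g s, {within `[0, 1], continuous (f \o edge_map rels g s)}) ->
  (forall g (r : rels), {within @unit_disc R, continuous (f \o disc_map g r)}) ->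
  continuous f.
Proof.
move=> fe fd; apply/continuousP => U oU; apply: cw_open => g s.
- by move/continuousP: (fe g s); exact.
- by move/continuousP: (fd g s); exact.
Qed.

Lemma continuous_edge_map g s : continuous (edge_map rels g s : R -> X).
Proof.
have -> : edge_map rels g s = edge_map rels g s \o clamp 0 1 :> (R -> X).
  by apply/funext => t; rewrite /= edge_map_clamp.
apply: (@continuous_within_comp R R X (`[0, 1] : set R)).
- by apply/continuousP => U [oU _]; exact: oU.
- exact: continuous_clamp.
- by move=> t; rewrite /= in_itv; exact: clamp_itv.
Qed.

Lemma continuous_disc_map g (r : rels) :
  {within @unit_disc R, continuous (disc_map g r : R * R -> X)}.
Proof. by apply/continuousP => U [_ oU]; exact: oU. Qed.

Lemma letter_path_le0 g l t : t <= 0 -> letter_path rels g l t = CV R rels g.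
Proof.
move=> t0; rewrite /letter_path; case: l.2; last by rewrite edge_map_le0.
by rewrite edge_map_ge1 ?mulgVK //; lra.
Qed.

Lemma letter_path_ge1 g l t :
  1 <= t -> letter_path rels g l t = CV R rels (g * leval l)%g.
Proof.
move=> t1; rewrite /letter_path /leval; case: l.2; last by rewrite edge_map_ge1.
by rewrite edge_map_le0 //; lra.
Qed.

Lemma word_path_le0 g w t : t <= 0 -> word_path rels g w t = CV R rels g.
Proof.
case: w => //= l w t0; rewrite ifT ?letter_path_le0 //.
exact: le_trans t0 ler01.
Qed.

Lemma word_path_ge g w t :
  (size w)%:R <= t -> word_path rels g w t = CV R rels (g * weval w)%g.
Proof.
elim: w g t => [|l w IH] g t /= wt; first by rewrite mulg1.
rewrite -natr1 in wt.
case: ifP => t1; last by rewrite IH ?mulgA //; lra.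
have w0 : (size w)%:R = 0 :> R by apply/le_anti; rewrite ler0n andbT; lra.
have {}w0 : w = [::] by apply/nilP; rewrite /nilp -(eqr_nat R) w0.
by move: wt; rewrite w0 /= mulg1 => wt; rewrite letter_path_ge1 //; lra.
Qed.

Lemma continuous_letter_path (T : topologicalType) (F : X -> T) :
  (forall g s, continuous (F \o edge_map rels g s)) ->
  forall g l, continuous (F \o letter_path rels g l).
Proof.
move=> cF g [s []]; last exact: cF.
move=> t; apply: (@continuous_comp _ _ _ (fun t : R => 1 - t)
  (F \o edge_map rels (g * (val s)^-1)%g s)); last exact: cF.
by apply: cvgB; [exact: cvg_cst|exact: cvg_id].
Qed.

Lemma continuous_word_path (T : topologicalType) (F : X -> T) :
  (forall g s, continuous (F \o edge_map rels g s)) ->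
  forall w g, continuous (F \o word_path rels g w).
Proof.
move=> cF; elim=> [|l w IH] g.
  have -> : F \o word_path rels g [::] = cst (F (CV R rels g)) by [].
  exact: cst_continuous.
have -> : F \o word_path rels g (l :: w) = (fun t => if t <= 1
    then (F \o letter_path rels g l) t
    else (F \o word_path rels (g * leval l)%g w \o (fun t => t - 1)) t).
  by apply/funext => t /=; case: ifP.
apply: continuous_if_le => [|t|]; first exact: continuous_letter_path.
  apply: continuous_comp; last exact: IH.
  by apply: cvgB; [exact: cvg_id|exact: cvg_cst].
by rewrite /= subrr letter_path_ge1 ?lexx ?word_path_le0 ?lexx.
Qed.

Section Glue.
Variables (T : Type) (fv : G -> T) (fe : G -> S -> R -> T).
Variable fd : G -> rels -> R * R -> T.

Definition cw_glue (x : X) : T :=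
  match x with
  | CV g => fv g
  | CE g s u => fe g s (val u)
  | CD g r p => fd g r (val p)
  end.

Hypothesis fe0 : forall g s, fe g s 0 = fv g.
Hypothesis fe1 : forall g s, fe g s 1 = fv (g * val s)%g.

Lemma cw_glue_edge_map g s t : cw_glue (edge_map rels g s t) = fe g s (clamp 0 1 t).
Proof.
have [t0|t0] := leP t 0; first by rewrite clamp_le // edge_map_le0 // fe0.
have [t1|t1] := leP 1 t; first by rewrite clamp_ge // edge_map_ge1 // fe1.
rewrite clamp_id ?ltW //.
have t01 : 0 < t < 1 by rewrite t0 t1.
by rewrite /edge_map insubT.
Qed.

End Glue.

Lemma disc_map_circle g (r : rels) (p : R * R) : circle p ->
  disc_map g r p = word_path rels g (val (val r)) ((size (val (val r)))%:R * turn p).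
Proof. by rewrite /circle /disc_map /= => pc; rewrite insubF // pc ltxx. Qed.

Lemma cw_glue_disc_map (T : Type) (fv : G -> T) (fe : G -> S -> R -> T)
    (fd : G -> rels -> R * R -> T) g (r : rels) p :
  (circle p -> fd g r p =
    cw_glue fv fe fd
      (word_path rels g (val (val r)) ((size (val (val r)))%:R * turn p))) ->
  unit_disc p -> cw_glue fv fe fd (disc_map g r p) = fd g r p.
Proof.
move=> fdp; rewrite /unit_disc /= le_eqVlt => /orP[/eqP p1|p1].
  by rewrite fdp // disc_map_circle.
by rewrite /disc_map insubT.
Qed.

Lemma cw_glue_continuous (T : topologicalType) (fv : G -> T) (fe : G -> S -> R -> T)
    (fd : G -> rels -> R * R -> T) :
  (forall g s, fe g s 0 = fv g) -> (forall g s, fe g s 1 = fv (g * val s)%g) ->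
  (forall g s, continuous (fe g s)) -> (forall g r, continuous (fd g r)) ->
  (forall g (r : rels) p, circle p -> fd g r p =
    cw_glue fv fe fd
      (word_path rels g (val (val r)) ((size (val (val r)))%:R * turn p))) ->
  continuous (cw_glue fv fe fd).
Proof.
move=> fe0 fe1 cfe cfd fdp; apply: cw_continuous => g s.
  apply: continuous_subspaceT.
  have -> : cw_glue fv fe fd \o edge_map rels g s = fe g s \o clamp 0 1.
    by apply/funext => t /=; rewrite cw_glue_edge_map.
  by move=> t; apply: continuous_comp; [exact: continuous_clamp|exact: cfe].
apply: (@subspace_eq_continuous _ _ _ (fd g s)); last exact: continuous_subspaceT.
by move=> p; rewrite inE => dp; rewrite /from_subspace /= cw_glue_disc_map //;
  exact: fdp.
Qed.

Hypothesis relP : forall r, r \in rels -> phi r = 1%g.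

Lemma rel_weval (r : rels) : weval (val (val r)) = 1%g.
Proof. by rewrite -/(phi _) relP //; exact: valP. Qed.

(** A function on the 1-skeleton extends over each 2-cell by [disc_extension]; the attaching path is
    closed because relators evaluate to 1. *)
Lemma real_extension (fv : G -> R) (fe : G -> S -> R -> R) :
  (forall g s, fe g s 0 = fv g) -> (forall g s, fe g s 1 = fv (g * val s)%g) ->
  (forall g s, continuous (fe g s)) ->
  exists F : X -> R, [/\ continuous F, forall g, F (CV R rels g) = fv g &
    forall g s t, F (edge_map rels g s t) = fe g s (clamp 0 1 t)].
Proof.
move=> fe0 fe1 cfe.
(* The value 0 on open 2-cells is a placeholder: [F0] is evaluated on edge paths only. *)
pose F0 := cw_glue fv fe (fun g (r : rels) p => 0).
pose ph g (r : rels) t := F0 (word_path rels g (val (val r)) t).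
have /choice[fd Hfd] : forall gr : G * rels, exists f : R * R -> R,
    continuous f /\ forall p, circle p ->
      f p = ph gr.1 gr.2 ((size (val (val gr.2)))%:R * turn p).
  move=> [g r] /=.
  have [|||E [cE EP _]] := @disc_extension R (ph g r) (size (val (val r)))%:R.
  - exact: ler0n.
  - apply: (@continuous_word_path _ F0) => g' s.
    have -> : F0 \o edge_map rels g' s = fe g' s \o clamp 0 1.
      by apply/funext => t /=; rewrite /F0 cw_glue_edge_map.
    by move=> t; apply: continuous_comp; [exact: continuous_clamp|exact: cfe].
  - by rewrite /ph word_path_le0 // word_path_ge // rel_weval mulg1.
  - by exists E.
exists (cw_glue fv fe (fun g r => fd (g, r))); split=> //; last first.
  by move=> g s t; rewrite cw_glue_edge_map.
apply: cw_glue_continuous => // [g r|g r p cp]; first exact: (Hfd (g, r)).1.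
rewrite (Hfd (g, r)).2 // /ph /=; set t := (_ * _); move: t.
elim: (val (val r)) g => //= l w IH g t; case: ifP => // _.
by rewrite /letter_path; case: l.2; rewrite /F0 !cw_glue_edge_map.
Qed.

End Complex.

(** * Maps to the circle given by integral cocycles *)

Lemma periodic_int (R : realType) (f : R -> R) :
  (forall y, f (y + pi *+ 2) = f y) ->
  forall y (m : int), f (2 * pi * (y + m%:~R)) = f (2 * pi * y).
Proof.
move=> f2 y m.
have fn (n : nat) z : f (2 * pi * (z + n%:R)) = f (2 * pi * z).
  elim: n => [|n IH]; first by rewrite addr0.
  by rewrite -natr1 -IH -[in RHS]f2; congr f; ring.
case: m => n; first exact: fn.
by rewrite NegzE intrN -[LHS](fn n.+1) subrK.
Qed.

Section CircleMap.
Variables (R : realType) (G : groupType) (S : {fset G}) (rels : {fset free_group S}).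
Local Notation X := (cayley_complex R rels).
Implicit Types (c : G -> S -> int) (g : G) (s : S) (l : S * bool) (w : word S) (t : R).

(** The lift to the line of theta_c along the path reading [w] from [g], starting at 0. Clamping
    freezes the contribution of a letter once it is traversed, so the final value is
    [path_val c g w]. *)
Fixpoint path_lift c g w t : R :=
  if w is l :: w' then
    (letter_val c g l)%:~R * clamp 0 1 t + path_lift c (g * leval l)%g w' (t - 1)
  else 0.

Lemma path_lift_le0 c g w t : t <= 0 -> path_lift c g w t = 0.
Proof.
elim: w g t => //= l w IH g t t0.
by rewrite clamp_le // mulr0 add0r IH //; lra.
Qed.

Lemma path_lift_ge c g w t :
  (size w)%:R <= t -> path_lift c g w t = (path_val c g w)%:~R.
Proof.
elim: w g t => //= l w IH g t; rewrite -natr1 => wt.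
rewrite clamp_ge //; last by have := ler0n R (size w); lra.
by rewrite mulr1 IH ?intrD //; lra.
Qed.

Lemma continuous_path_lift c g w : continuous (path_lift c g w).
Proof.
elim: w g => [|l w IH] g t; first exact: cvg_cst.
apply: cvgD.
  by apply: cvgM; [exact: cvg_cst|exact: continuous_clamp].
apply: (@continuous_comp _ _ _ (fun t : R => t - 1)
  (path_lift c (g * leval l)%g w)); last exact: IH.
by apply: cvgB; [exact: cvg_id|exact: cvg_cst].
Qed.

(* [lam] is a discontinuous lift of theta_c: on the edge [(g, s)] it is
   [c g s * t], but it is 0 at every vertex. *)
Lemma circle_map c :
  (forall g (r : rels), path_val c g (val (val r)) = 0) ->
  exists lam : X -> R, [/\
    continuous (fun x => cos (2 * pi * lam x)),
    continuous (fun x => sin (2 * pi * lam x)),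
    forall g w t, cos (2 * pi * lam (word_path rels g w t)) =
                    cos (2 * pi * path_lift c g w t) /\
                  sin (2 * pi * lam (word_path rels g w t)) =
                    sin (2 * pi * path_lift c g w t),
    forall g s t, c g s = 0 -> cos (2 * pi * lam (edge_map rels g s t)) = 1 &
    forall g (r : rels) p,
      (forall t, path_lift c g (val (val r)) t = 0) ->
      cos (2 * pi * lam (disc_map g r p)) = 1].
Proof.
move=> crel.
(* By the cocycle condition the lift along an attaching loop returns to 0, hence extends over the
   disc. *)
have /choice[fd Hfd] : forall gr : G * rels, exists E : R * R -> R, [/\ continuous E,
    forall p, circle p ->
      E p = path_lift c gr.1 (val (val gr.2)) ((size (val (val gr.2)))%:R * turn p) &
    (forall t, path_lift c gr.1 (val (val gr.2)) t = 0) -> forall p, E p = 0].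
  move=> [g r] /=; apply: disc_extension => //; first exact: continuous_path_lift.
  by rewrite path_lift_le0 // path_lift_ge // crel.
pose fv := fun _ : G => 0 : R.
pose fe g s t : R := (c g s)%:~R * t.
pose fdd g (r : rels) := fd (g, r).
pose lam : X -> R := cw_glue fv fe fdd.
have E f : (forall y (m : int), f (2 * pi * (y + m%:~R)) = f (2 * pi * y)) ->
    forall g s t, f (2 * pi * lam (edge_map rels g s t)) =
                  f (2 * pi * fe g s (clamp 0 1 t)) :> R.
  move=> fm g s t; rewrite /lam.
  have [t0|t0] := leP t 0; first by rewrite clamp_le // edge_map_le0 //= /fe !mulr0.
  have [t1|t1] := leP 1 t.
    rewrite clamp_ge // edge_map_ge1 // /fe /= mulr1 /fv.
    by rewrite -[X in _ = f (_ * X)]add0r fm.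
  have t01 : 0 < t < 1 by rewrite t0 t1.
  by rewrite clamp_id ?ltW // /edge_map insubT.
(* Along any edge path, [lam] and [path_lift] agree modulo integers. *)
have W f : (forall y (m : int), f (2 * pi * (y + m%:~R)) = f (2 * pi * y)) ->
    forall g w t, f (2 * pi * lam (word_path rels g w t)) =
                  f (2 * pi * path_lift c g w t) :> R.
  move=> fm g w t; elim: w g t => //= l w IH g t.
  case: ifP => t1; last first.
    rewrite IH clamp_ge ?ltW //; last by rewrite ltNge t1.
    by rewrite mulr1 [in RHS]addrC fm.
  rewrite path_lift_le0; last by lra.
  rewrite addr0 /letter_path /letter_val; case: l.2; rewrite E // /fe.
  have -> : clamp 0 1 (1 - t) = 1 - clamp 0 1 t.
    have [t0|t0] := leP t 0.
      by rewrite (clamp_le t0) // clamp_ge ?subr0 //; lra.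
    by rewrite !clamp_id //; apply/andP; split; lra.
  (* On an edge traversed backwards, k (1 - t) and - k t differ by the integer k. *)
  set k := c _ _; rewrite -[LHS](fm _ (- k)); congr f; rewrite !intrN; ring.
have C f : continuous f ->
    (forall y (m : int), f (2 * pi * (y + m%:~R)) = f (2 * pi * y)) ->
    continuous (fun x : X => f (2 * pi * lam x) : R).
  move=> cf fm.
  have c2 (h : R -> R) : continuous h -> continuous (fun t => f (2 * pi * h t)).
    move=> ch t; apply: (@continuous_comp _ _ _ (fun t => 2 * pi * h t) f) => //.
      by apply: cvgM; [exact: cvg_cst|exact: ch].
    exact: cf.
  have -> : (fun x : X => f (2 * pi * lam x)) = cw_glue (fun=> f 0)
     (fun g s t => f (2 * pi * fe g s t)) (fun g r p => f (2 * pi * fdd g r p)).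
    by apply/funext => -[g|g s u|g r u] //=; rewrite /fv mulr0.
  apply: cw_glue_continuous => [g s|g s|g s|g r|g r p cp].
  - by rewrite /fe !mulr0.
  - by rewrite /fe mulr1 -[X in _ * X]add0r fm mulr0.
  - by apply: c2 => t; apply: cvgM; [exact: cvg_cst|exact: cvg_id].
  - move=> p; have [cE _ _] := Hfd (g, r).
    apply: (@continuous_comp _ _ _ (fun p => 2 * pi * fdd g r p) f) => //.
      by apply: cvgM; [exact: cvg_cst|exact: cE].
    exact: cf.
  - rewrite /fdd; have [_ -> // _] := Hfd (g, r).
    rewrite -W //; set x := word_path _ _ _ _; case: x => [g'|g' s' u|g' r' u] //=.
    by rewrite /fv mulr0.
have cosP := periodic_int (@cosD2pi R); have sinP := periodic_int (@sinD2pi R).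
exists lam; split.
- exact: (C _ (@continuous_cos R) cosP).
- exact: (C _ (@continuous_sin R) sinP).
- by move=> g w t; split; [exact: (W _ cosP)|exact: (W _ sinP)].
- by move=> g s t cgs; rewrite (E _ cosP) /fe cgs mul0r mulr0 cos0.
- move=> g r p H; have [_ _ E0] := Hfd (g, r).
  rewrite /disc_map; case: insubP => [u _ _|_].
    by rewrite /lam /= /fdd E0 // mulr0 cos0.
  by rewrite (W _ cosP) H mulr0 cos0.
Qed.

End CircleMap.

(** * The Hausdorff property, and proper rays *)

Lemma hausdorff_separating (T : topologicalType) (R : realType) :
  (forall x y : T, x <> y -> exists F : T -> R, continuous F /\ F x <> F y) ->
  hausdorff_space T.
Proof.
move=> sep x y xy; apply: contrapT => /sep[F [cF]]; apply.
apply: (@Rhausdorff R) => A B /(cF x) /= FA /(cF y) /= FB.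
by have [z [Az Bz]] := xy _ _ FA FB; exists (F z).
Qed.

Section Hausdorff.
Variables (R : realType) (G : groupType) (S : {fset G}) (rels : {fset free_group S}).
Hypothesis relP : forall r, r \in rels -> phi r = 1%g.
Local Notation X := (cayley_complex R rels).
Implicit Types (g : G) (s : S).

Definition affine_edge (fv : G -> R) g s (t : R) : R :=
  fv g * (1 - t) + fv (g * val s)%g * t.

Lemma vertex_extension (fv : G -> R) :
  exists F : X -> R, [/\ continuous F, forall g, F (CV R rels g) = fv g &
    forall g s t, F (edge_map rels g s t) = affine_edge fv g s (clamp 0 1 t)].
Proof.
apply: real_extension => // g s.
- by rewrite /affine_edge subr0 mulr1 mulr0 addr0.
- by rewrite /affine_edge subrr mulr1 mulr0 add0r.
- move=> t; apply: cvgD; apply: cvgM; try exact: cvg_cst; last exact: cvg_id.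
  by apply: cvgB; [exact: cvg_cst|exact: cvg_id].
Qed.

Let sep (x y : X) := exists F : X -> R, continuous F /\ F x <> F y.

Let sepC x y : sep x y -> sep y x.
Proof. by move=> [F [cF xy]]; exists F; split=> // /esym. Qed.

Let sepVV g h : CV R rels g <> CV R rels h -> sep (CV R rels g) (CV R rels h).
Proof.
move=> gh; have [F [cF FV _]] := vertex_extension (fun k => (k == g)%:R).
exists F; split=> //; rewrite !FV eqxx.
case: (eqVneq h g) => [E|_]; first by rewrite E in gh.
by move/eqP; rewrite oner_eq0.
Qed.

(** The polynomial t (1 - t) (t - a) vanishes at the ends of the edge and, inside it, only at [a];
    with a = -1 it has no zero in the open edge. *)
Let edge_bump g s (a : R) : exists F : X -> R, [/\ continuous F,
   forall h, F (CV R rels h) = 0,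
   forall u, F (CE rels g s u) = val u * (1 - val u) * (val u - a) &
   forall h k u, (h, k) <> (g, s) -> F (CE rels h k u) = 0].
Proof.
pose fe h k (t : R) := if (h, k) == (g, s) then t * (1 - t) * (t - a) else 0.
have [||h k t|F [cF FV FE]] := @real_extension R G S rels relP (fun=> 0) fe.
- by move=> h k; rewrite /fe; case: ifP => _ //; rewrite !mul0r.
- by move=> h k; rewrite /fe; case: ifP => _ //; rewrite subrr mulr0 mul0r.
- rewrite /fe; case: ((h, k) == (g, s)); last exact: cvg_cst.
  apply: cvgM; last by apply: cvgB; [exact: cvg_id|exact: cvg_cst].
  apply: cvgM; first exact: cvg_id.
  by apply: cvgB; [exact: cvg_cst|exact: cvg_id].
have FC h k (u : {t : R | 0 < t < 1}) : F (CE rels h k u) = fe h k (val u).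
  rewrite -edge_map_CE FE clamp_id //.
  by case/andP: (valP u) => ? ?; rewrite !ltW.
exists F; split=> // [u|h k u hk]; rewrite FC /fe; first by rewrite eqxx.
by case: eqP.
Qed.

Let edge_bump_neq0 (u : {t : R | 0 < t < 1}) (a : R) :
  val u <> a -> val u * (1 - val u) * (val u - a) != 0.
Proof.
move=> /eqP ua; case/andP: (valP u) => u0 u1.
by rewrite !mulf_neq0 ?subr_eq0 // ?gt_eqF.
Qed.

Let sepEV g s u h : sep (CE rels g s u) (CV R rels h).
Proof.
have [F [cF FV FE _]] := edge_bump g s (-1); exists F; split=> //.
rewrite FV FE; apply/eqP/edge_bump_neq0.
by case/andP: (valP u) => u0 _ E; rewrite E ltr0N1 in u0.
Qed.

Let sepEE g s u h k v : CE rels g s u <> CE rels h k v ->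
  sep (CE rels g s u) (CE rels h k v).
Proof.
move=> uv; have [[hg ks]|hk] := pselect ((h, k) = (g, s)).
  have [F [cF FV FE _]] := edge_bump g s (val v); exists F; split=> //.
  rewrite hg ks !FE subrr mulr0; apply/eqP/edge_bump_neq0 => /val_inj E.
  by apply: uv; rewrite hg ks E.
have [F [cF FV FE F0]] := edge_bump g s (-1); exists F; split=> //.
rewrite FE F0 //; apply/eqP/edge_bump_neq0.
by case/andP: (valP u) => u0 _ E; rewrite E ltr0N1 in u0.
Qed.

(** The factor 1 - |p|^2 kills the boundary circle, and |p - q|^2 vanishes only at [q]; the choice q
    = (2, 0), outside the disc, leaves no zero in the open cell. *)
Let disc_bump g (r : rels) (q : R * R) : exists F : X -> R, [/\ continuous F,
   forall h, F (CV R rels h) = 0,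
   forall h k u, F (CE rels h k u) = 0,
   forall p, F (CD g r p) = (1 - ((val p).1 ^+ 2 + (val p).2 ^+ 2)) *
     (((val p).1 - q.1) ^+ 2 + ((val p).2 - q.2) ^+ 2) &
   forall h r' p, (h, r') <> (g, r) -> F (CD h r' p) = 0].
Proof.
pose fd h (r' : rels) (p : R * R) := if (h, r') == (g, r) then
  (1 - (p.1 ^+ 2 + p.2 ^+ 2)) * ((p.1 - q.1) ^+ 2 + (p.2 - q.2) ^+ 2) else 0.
exists (cw_glue (fun=> 0) (fun _ _ _ => 0) fd); split=> //=.
- apply: cw_glue_continuous => // [h s|h r'|h r' p cp].
  + exact: cst_continuous.
  + rewrite /fd; case: ((h, r') == (g, r)); last exact: cst_continuous.
    have c1 p : {for p, continuous (fst : R * R -> R)} by exact: cvg_fst.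
    have c2 p : {for p, continuous (snd : R * R -> R)} by exact: cvg_snd.
    move=> p; apply: cvgM.
      apply: cvgB; first exact: cvg_cst.
      by apply: cvgD; apply: cvgM; (exact: c1 || exact: c2).
    by apply: cvgD; apply: cvgM; apply: cvgB;
      (exact: cvg_cst || exact: c1 || exact: c2).
  + rewrite /fd; set x := word_path _ _ _ _.
    have -> : cw_glue (fun=> 0) (fun _ _ _ => 0) (fun h (r0 : rels) p0 =>
        if (h, r0) == (g, r) then (1 - (p0.1 ^+ 2 + p0.2 ^+ 2)) *
        ((p0.1 - q.1) ^+ 2 + (p0.2 - q.2) ^+ 2) else 0) x = 0 :> R.
      rewrite /x; move: (_ * turn p); elim: (val (val r')) h {x} => //= l w IH h t.
      case: ifP => // _; rewrite /letter_path.
      by case: l.2; rewrite cw_glue_edge_map.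
    by case: ifP => // _; rewrite cp subrr mul0r.
- by move=> p; rewrite /fd eqxx.
- by move=> h r' p hr; rewrite /fd; case: eqP.
Qed.

Let disc_bump_neq0 (p : {p : R * R | p.1 ^+ 2 + p.2 ^+ 2 < 1}) (q : R * R) :
  val p <> q -> (1 - ((val p).1 ^+ 2 + (val p).2 ^+ 2)) *
     (((val p).1 - q.1) ^+ 2 + ((val p).2 - q.2) ^+ 2) != 0.
Proof.
move=> pq; rewrite mulf_neq0 //.
  by rewrite subr_eq0 eq_sym lt_eqF //; exact: (valP p).
rewrite paddr_eq0 ?sqr_ge0 // !sqrf_eq0 !subr_eq0; apply/negP => /andP[/eqP E1 /eqP E2].
by apply: pq; rewrite (surjective_pairing (val p)) E1 E2 -surjective_pairing.
Qed.

Let disc_neq (p : {p : R * R | p.1 ^+ 2 + p.2 ^+ 2 < 1}) : val p <> (2, 0).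
Proof.
by move=> E; have := valP p; rewrite /= E /=; lra.
Qed.

Let sepD g (r : rels) p y : CD g r p <> y -> sep (CD g r p) y.
Proof.
case: y => [h|h k v|h r' p'] py.
- have [F [cF FV FE FD _]] := disc_bump g r (2, 0); exists F; split=> //.
  by rewrite FV FD; apply/eqP/disc_bump_neq0/disc_neq.
- have [F [cF FV FE FD _]] := disc_bump g r (2, 0); exists F; split=> //.
  by rewrite FE FD; apply/eqP/disc_bump_neq0/disc_neq.
have [[hg kr]|hk] := pselect ((h, r') = (g, r)).
  have [F [cF FV FE FD _]] := disc_bump g r (val p'); exists F; split=> //.
  rewrite hg kr !FD !subrr expr0n addr0 mulr0; apply/eqP/disc_bump_neq0 => /val_inj E.
  by apply: py; rewrite hg kr E.
have [F [cF FV FE FD F0]] := disc_bump g r (2, 0); exists F; split=> //.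
by rewrite FD F0 //; apply/eqP/disc_bump_neq0/disc_neq.
Qed.

Lemma cayley_hausdorff : hausdorff_space X.
Proof.
apply: (@hausdorff_separating _ R) => x y.
case: x => [g|g s u|g r p] xy; last exact: sepD.
- case: y xy => [h|h k v|h r' p'] xy; first exact: sepVV.
    exact/sepC/sepEV.
  by apply/sepC/sepD => /esym.
- case: y xy => [h|h k v|h r' p'] xy; [exact: sepEV|exact: sepEE|].
  by apply/sepC/sepD => /esym.
Qed.

End Hausdorff.

(** * Edge path rays reading an infinite word *)

Section Rays.
Variables (R : realType) (G : groupType) (S : {fset G}) (rels : {fset free_group S}).
Hypothesis relP : forall r, r \in rels -> phi r = 1%g.
Local Notation X := (cayley_complex R rels).
Implicit Types (g : G) (s : S) (l : nat -> S * bool) (w : word S) (t : R).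

Lemma word_path_catl g w w' t :
  t <= (size w)%:R -> word_path rels g (w ++ w') t = word_path rels g w t.
Proof.
elim: w g t => [|k w IH] g t /=; first by move=> t0; rewrite word_path_le0.
by rewrite -natr1 => wt; case: ifP => // _; rewrite IH //; lra.
Qed.

Lemma word_path_rcons g w k t : 0 <= t <= 1 ->
  word_path rels g (rcons w k) ((size w)%:R + t) = letter_path rels (g * weval w)%g k t.
Proof.
move=> /andP[t0 t1]; elim: w g => [|m w IH] g; first by rewrite /= add0r t1 mulg1.
rewrite /= -natr1; case: ifP => wt; last first.
  by rewrite mulgA -IH; congr (word_path _ _ _ _); lra.
have w0' := ler0n R (size w).
have w0 : (size w)%:R = 0 :> R by lra.
have t0' : t = 0 by lra.
have {w0} wn : w = [::] by apply/nilP; rewrite /nilp -(eqr_nat R) w0.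
by rewrite wn t0' /= mulg1 addr0 add0r letter_path_ge1 // letter_path_le0.
Qed.

(** A prefix with floor(t) + 1 letters reaches beyond time t >= 0, and by [rayE] every sufficiently
    long prefix gives the same point. *)
Definition ray l t : X := word_path rels 1%g (mkseq l (Num.truncn t).+1) t.

Lemma mkseq_cat T (f : nat -> T) m n : (m <= n)%N ->
  exists r : seq T, mkseq f n = mkseq f m ++ r.
Proof.
move=> mn; exists (map f (iota m (n - m))).
by rewrite /mkseq -map_cat -[X in iota 0 X](subnKC mn) iotaD.
Qed.

Lemma rayE l n t : t <= n%:R -> ray l t = word_path rels 1%g (mkseq l n) t.
Proof.
move=> tn; rewrite /ray; set m := (Num.truncn t).+1.
have tm : t <= m%:R by exact/ltW/truncnS_gt.
have [mn|/ltnW nm] := leqP m n.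
  have [s ->] := mkseq_cat l mn.
  by rewrite word_path_catl // size_mkseq.
have [s ->] := mkseq_cat l nm.
by rewrite word_path_catl // size_mkseq.
Qed.

Lemma ray_edge l n t : 0 <= t <= 1 ->
  ray l (n%:R + t) = letter_path rels (weval (mkseq l n)) (l n) t.
Proof.
move=> t01; rewrite (@rayE _ n.+1); last by rewrite -natr1; case/andP: t01; lra.
have := word_path_rcons 1%g (mkseq l n) (l n) t01.
by rewrite size_mkseq mul1g mkseqS.
Qed.

Lemma continuous_ray l : continuous (ray l).
Proof.
move=> t; set n := (Num.truncn t).+1.
have tn : t < n%:R by exact: truncnS_gt.
have E : \forall u \near t, word_path rels 1%g (mkseq l n) u = ray l u.
  near=> u; rewrite (@rayE _ n) //; apply/ltW; near: u; exact: lt_nbhsl.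
rewrite /continuous_at (rayE l (ltW tn)).
apply: cvg_trans (near_eq_cvg E) _.
apply: (@continuous_word_path _ _ _ _ _ id) => g s; exact: continuous_edge_map.
Unshelve. all: by end_near. Qed.

Lemma letter_path_affine (F : X -> R) (fv : G -> R) g k t :
  (forall g s t, F (edge_map rels g s t) = affine_edge fv g s (clamp 0 1 t)) ->
  0 <= t <= 1 ->
  F (letter_path rels g k t) = fv g * (1 - t) + fv (g * leval k)%g * t.
Proof.
move=> FE t01; rewrite /letter_path /leval; case: k.2; rewrite FE clamp_id //.
  by rewrite /affine_edge mulgVK; ring.
by case/andP: t01; lra.
Qed.

(** [h] extends to a continuous function on X that is affine on edges. It is bounded on a compact
    set but tends to infinity along the ray. *)
Lemma proper_ray l (h : G -> int) :
  (forall M, exists N, forall n, (N <= n)%N -> M <= h (weval (mkseq l n))) ->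
  proper_edge_path_ray (ray l).
Proof.
move=> hN; split; last first.
  by move=> n; exists (weval (mkseq l n)), (l n) => t; exact: ray_edge.
split; first exact/continuous_subspaceT/continuous_ray.
move=> K cK.
have [F [cF FV FE]] := @vertex_extension R G S rels relP (fun g => (h g)%:~R).
have [M HM] : exists M : R, forall x, K x -> F x <= M.
  have cFK : compact (F @` K).
    by apply: continuous_compact cK; exact: continuous_subspaceT.
  have [M [_ HM]] := compact_bounded cFK.
  exists (M + 1) => x Kx; apply: le_trans (ler_norm _) _.
  by apply: (HM (M + 1)); [rewrite ltrDl|exists x].
have [N HN] := hN (Num.ceil (M + 1)).
(* The preimage of [K] is closed, as compact sets are closed in the Hausdorff space X, and it lies
   in [0, N]. *)
apply: (@subclosed_compact _ _ (`[0, N%:R] : set R)).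
- apply: closedI; first exact: interval_closed.
  apply: closed_comp => [t _|]; first exact: continuous_ray.
  by apply: compact_closed => //; exact: cayley_hausdorff.
- exact: segment_compact.
- move=> t [/=]; rewrite !in_itv /= andbT => t0 Kt; rewrite t0 /=.
  rewrite leNgt; apply/negP => Nt.
  have /andP[] := truncn_itv t0; set n := Num.truncn t => nt tn.
  have := HM _ Kt; have {1}-> : t = n%:R + (t - n%:R) by lra.
  have t01 : 0 <= t - n%:R <= 1 by rewrite -natr1 in tn; apply/andP; lra.
  rewrite ray_edge // (letter_path_affine _ _ FE) //.
  have Nn : (N <= n)%N by rewrite -ltnS -(ltr_nat R) (lt_trans Nt).
  have big m : (N <= m)%N -> M + 1 <= (h (weval (mkseq l m)))%:~R.
    by move=> /HN Hm; apply: le_trans (ceil_ge _) _; rewrite ler_int.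
  have := big n Nn; have := big n.+1 (leqW Nn).
  rewrite mkseqS -cats1 weval_cat /= mulg1.
  set a := _%:~R; set b := _%:~R; set u := t - n%:R in t01 * => Ha Hb.
  case/andP: t01 => u0 u1.
  (* Past time N, the value of [F] is a convex combination of two vertex values that are at least M
     + 1, against the bound M on [K]. *)
  have : 0 <= (b - (M + 1)) * (1 - u) + (a - (M + 1)) * u.
    by apply: addr_ge0; apply: mulr_ge0; lra.
  lra.
Qed.

End Rays.

(** * The winding obstruction *)

Lemma finite_bigcup_compact (T : topologicalType) (I : choiceType) (D : set I)
    (F : I -> set T) :
  finite_set D -> (forall i, compact (F i)) -> compact (\bigcup_(i in D) F i).
Proof.
by move=> /finite_seqP[s ->] cF; rewrite bigcup_seq; exact: bigsetU_compact.
Qed.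

Lemma compact_unit_disc (R : realType) : compact (@unit_disc R).
Proof.
apply: (@subclosed_compact _ _ ((`[-1, 1] : set R) `*` (`[-1, 1] : set R))).
- rewrite (_ : @unit_disc R = (fun p => p.1 ^+ 2 + p.2 ^+ 2) @^-1` [set t | t <= 1]) //.
  apply: closed_comp => [p _|]; last exact: closed_le.
  have c1 : {for p, continuous (fst : R * R -> R)} by exact: cvg_fst.
  have c2 : {for p, continuous (snd : R * R -> R)} by exact: cvg_snd.
  by apply: cvgD; apply: cvgM; (exact: c1 || exact: c2).
- by apply: compact_setX; exact: segment_compact.
- move=> p; rewrite /unit_disc /= => p1.
  by split; rewrite /= in_itv /=; apply/andP; nra.
Qed.

Section Main.
Variables (R : realType) (G : groupType) (S : {fset G}) (rels : {fset free_group S}).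
Local Notation X := (cayley_complex R rels).
Implicit Types (g : G) (l : nat -> S * bool) (w : word S) (t : R).

Lemma finite_path_lift (c : G -> S -> int) w :
  finite_set [set g | exists s, c g s != 0] ->
  finite_set [set g | exists t, path_lift c g w t != 0].
Proof.
move=> cfin; elim: w => [|l w IH].
  by rewrite (_ : [set _ | _] = set0) // -subset0 => g [t] /=; rewrite eqxx.
have fl : finite_set [set g | letter_val c g l != 0].
  rewrite /letter_val; case: l => s [] /=; last first.
    by apply: sub_finite_set cfin => g /= ?; exists s.
  apply: (@sub_finite_set _ _ ((fun g => g * (val s)^-1)%g @^-1`
     [set g | exists s, c g s != 0])).
    by move=> g /=; rewrite oppr_eq0 => ?; exists s.
  by apply: finite_preimage => // ? ? _ _ /mulIg.
apply: (@sub_finite_set _ _ ([set g | letter_val c g l != 0] `|`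
  (fun g => g * leval l)%g @^-1` [set g | exists t, path_lift c g w t != 0])).
  move=> g [t /= H]; case: (eqVneq (letter_val c g l) 0) => [E|]; last by left.
  by right; exists (t - 1); move: H; rewrite E mul0r add0r.
by rewrite finite_setU; split=> //; apply: finite_preimage => // ? ? _ _ /mulIg.
Qed.

Lemma path_lift_eventually0 (c : nat -> G -> S -> int) w g :
  (forall g s, exists J, forall j, (J <= j)%N -> c j g s = 0) ->
  exists J, forall j, (J <= j)%N -> forall t, path_lift (c j) g w t = 0.
Proof.
move=> cev; elim: w g => [|l w IH] g; first by exists 0.
have [J1 H1] := IH (g * leval l)%g.
have [J2 H2] : exists J, forall j, (J <= j)%N -> letter_val (c j) g l = 0.
  rewrite /letter_val; case: l.2; last exact: cev.
  have [J HJ] := cev (g * (val l.1)^-1)%g l.1.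
  by exists J => j /HJ ->; rewrite oppr0.
exists (maxn J1 J2) => j; rewrite geq_max => /andP[j1 j2] t.
by rewrite /= H1 // H2 // mul0r addr0.
Qed.

Lemma open_finite_conj (T : topologicalType) (P : nat -> set T) (m n : nat) :
  (forall j, open (P j)) -> open [set x | forall j, (m <= j < n)%N -> P j x].
Proof.
move=> oP; elim: n => [|n IH].
  rewrite (_ : [set _ | _] = setT); first exact: openT.
  by apply/seteqP; split=> // x _ j; rewrite ltn0 andbF.
have [mn|nm] := leqP m n; last first.
  rewrite (_ : [set _ | _] = setT); first exact: openT.
  apply/seteqP; split=> // x _ j /andP[mj jn].
  by have := leq_trans nm mj; rewrite ltnNge -ltnS jn.
rewrite (_ : [set _ | _] = [set x | forall j, (m <= j < n)%N -> P j x] `&` P n).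
  exact: openI.
apply/seteqP; split=> x /=.
  move=> H; split; last by apply: H; rewrite mn ltnSn.
  by move=> j /andP[mj jn]; apply: H; rewrite mj ltnW.
case=> H1 H2 j; rewrite ltnS [(j <= n)%N]leq_eqVlt => /andP[mj /orP[/eqP->//|jn]].
by apply: H1; rewrite mj.
Qed.

Section Winding.
Variables (c : nat -> G -> S -> int) (l l' : nat -> S * bool).
Hypothesis crel : forall j g (r : rels), path_val (c j) g (val (val r)) = 0.
Hypothesis cfin : forall j, finite_set [set g | exists s, c j g s != 0].
Hypothesis cev : forall g s, exists J, forall j, (J <= j)%N -> c j g s = 0.
Hypothesis winding : forall j N, exists n, [/\ (N <= n)%N,
  path_val (c j) 1%g (mkseq l n) = 1 & path_val (c j) 1%g (mkseq l' n) = 0].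

Lemma ray_not_homotopic : ~ properly_homotopic (ray rels l : R -> X) (ray rels l').
Proof.
move=> [H [[cH pH] H0 H1]].
have /choice[lam Hlam] := fun j => circle_map R (crel j).
pose U j x : R := cos (2 * pi * lam j x).
have cU j : continuous (U j) by case: (Hlam j).
have Uword j g w t : U j (word_path rels g w t) = cos (2 * pi * path_lift (c j) g w t).
  by case: (Hlam j) => _ _ + _ _ => /(_ g w t)[].
have Uedge j g s t : c j g s = 0 -> U j (edge_map rels g s t) = 1.
  by case: (Hlam j) => _ _ _ + _; exact.
have Udisc j g (r : rels) p :
    (forall t, path_lift (c j) g (val (val r)) t = 0) -> U j (disc_map g r p) = 1.
  by case: (Hlam j) => _ _ _ _; exact.
(* [V J] is open because on a given cell all but finitely many of the
   conditions hold automatically. *)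
pose V J := [set x : X | forall j, (J <= j)%N -> 0 < U j x].
have oV J : open (V J).
  have o j : open [set x : X | 0 < U j x].
    by move/continuousP: (cU j) => /(_ _ (@open_gt R 0)).
  have eqV (Y : Type) (e : Y -> X) J' :
      (forall j, (J' <= j)%N -> forall y, U j (e y) = 1) ->
      e @^-1` V J = [set y | forall j, (J <= j < J')%N -> 0 < U j (e y)].
    move=> HJ'; apply/seteqP; split=> y /= Hy j; first by case/andP => /Hy.
    by case: (ltnP j J') => [jJ' Jj|/HJ' -> _]; [apply: Hy; rewrite Jj|].
  apply: cw_open => g s.
    have [J' HJ'] := cev g s.
    rewrite (eqV _ _ J'); last by move=> j /HJ' ? t; exact: Uedge.
    apply: (@open_finite_conj (subspace (`[0, 1] : set R))) => j; exact: (o j).1.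
  have [J' HJ'] := path_lift_eventually0 (val (val s)) g cev.
  rewrite (eqV _ _ J'); last by move=> j /HJ' ? t; exact: Udisc.
  apply: (@open_finite_conj (subspace (@unit_disc R))) => j; exact: (o j).2.
have xV x : exists J, V J x.
  case: x => [g|g s u|g r p].
  - exists 0 => j _; rewrite (_ : CV R rels g = word_path rels g [::] 0) //.
    by rewrite Uword mulr0 cos0.
  - have [J HJ] := cev g s; exists J => j /HJ cj.
    by rewrite -edge_map_CE Uedge.
  - have [J HJ] := path_lift_eventually0 (val (val r)) g cev.
    exists J => j /HJ cj; rewrite (_ : CD g r p = disc_map g r (val p)).
      by rewrite Udisc.
    by rewrite /disc_map valK.
pose K0 : set (R * R) := `[0, +oo[ `*` `[0, 1].
(* A retraction of the plane onto the half strip: [circle_square] needs maps continuous on the whole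
   plane, whereas [H] is continuous only within [K0]. *)
pose cl (p : R * R) := (Num.max 0 p.1, clamp 0 1 p.2).
have ccl : continuous cl.
  move=> p; apply: (@continuous_pair _ _ _ (fun p : R * R => Num.max 0 p.1)
    (fun p => clamp 0 1 p.2)).
    by apply: continuous_max; [exact: cvg_cst|exact: cvg_fst].
  apply: (@continuous_comp _ _ _ snd (clamp 0 1)); first exact: cvg_snd.
  exact: continuous_clamp.
pose H' := H \o cl.
have cH' : continuous H'.
  apply: (continuous_within_comp cH ccl) => p; split; rewrite /= in_itv /=.
    by rewrite le_max lexx.
  by apply: clamp_itv.
have H'E t s : 0 <= t -> 0 <= s <= 1 -> H' (t, s) = H (t, s).
  by move=> t0 s01; rewrite /H' /cl /= clamp_id // max_r.
(* The sets [V J] are open, increase with J and cover X, so a single one contains the compact path s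
   |-> H(0, s). *)
have [j Hj] : exists J, forall s, 0 <= s <= 1 -> V J (H' (0, s)).
  have := (compact_near_coveringP _).1 (@segment_compact R 0 1) nat \oo
    (fun J s => V J (H' (0, s))).
  case=> [s _|J _ /(_ J (leqnn J)) HJ]; last first.
    by exists J => s s01; apply: HJ; rewrite /= in_itv.
  have [J VJ] := xV (H' (0, s)).
  have nV : \forall s' \near s, V J (H' (0, s')).
    have cs : continuous (fun s : R => H' (0, s)).
      move=> s'.
      apply: (@continuous_comp _ _ _ (fun s : R => (0, s)) H'); last exact: cH'.
      by apply: (@continuous_pair _ _ _ (fun=> 0) id); [exact: cvg_cst|exact: cvg_id].
    exact: cs _ (open_nbhs_nbhs (conj (oV J) VJ)).
  exists ([set s' | V J (H' (0, s'))], [set J' | (J <= J')%N]).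
    by split=> //; exists J.
  by case=> s' J' /= [Vs JJ'] i J'i; apply: Vs; exact: leq_trans J'i.
(* [K] consists of the closed edges issuing from the finitely many vertices in the support of [c j],
   and of the closed 2-cells whose boundary lift is not identically 0. *)
have [K [cK KU]] : exists K : set X, compact K /\ forall x, ~ K x -> U j x = 1.
  exists ((\bigcup_(g in [set g | exists s, c j g s != 0])
             \bigcup_(s in [set: S]) (edge_map rels g s @` `[0, 1])) `|`
          (\bigcup_(r in [set: rels])
             \bigcup_(g in [set g |
                 exists t : R, path_lift (c j) g (val (val r)) t != 0])
              (disc_map g r @` @unit_disc R))).
  split.
    apply: compactU; apply: finite_bigcup_compact => [|i].
    - exact: cfin.
    - apply: finite_bigcup_compact => [|s]; first exact: finite_finset.
      apply: continuous_compact; last exact: segment_compact.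
      exact/continuous_subspaceT/continuous_edge_map.
    - exact: finite_finset.
    - apply: finite_bigcup_compact => [|g]; first exact/finite_path_lift/cfin.
      apply: continuous_compact; last exact: compact_unit_disc.
      exact: continuous_disc_map.
  case=> [g|g s u|g r p] nK.
  - rewrite (_ : CV R rels g = word_path rels g [::] 0) //.
    by rewrite Uword mulr0 cos0.
  - rewrite -edge_map_CE Uedge //; apply: contrapT => /eqP cgs; apply: nK; left.
    exists g; first by exists s.
    exists s => //; exists (val u); last exact: edge_map_CE.
    by have /andP[? ?] := valP u; rewrite /= in_itv /= !ltW.
  - have Ep : CD g r p = disc_map g r (val p) by rewrite /disc_map valK.
    rewrite Ep Udisc // => t; apply: contrapT => /eqP cgr; apply: nK; right.
    exists r => //; exists g; first by exists t.
    by exists (val p) => //; have := valP p; rewrite /unit_disc /= => /ltW.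
(* Properness of [H] bounds the times at which the homotopy meets [K]. *)
have [M HM] : exists M : R, forall t s, 0 <= t -> 0 <= s <= 1 -> K (H (t, s)) -> t <= M.
  have cKt : compact (fst @` (K0 `&` H @^-1` K)).
    apply: continuous_compact; last exact: pH.
    by apply: continuous_subspaceT => p; exact: cvg_fst.
  have [M [_ HM]] := compact_bounded cKt.
  exists (M + 1) => t s t0 s01 Kts; apply: le_trans (ler_norm _) _.
  apply: (HM (M + 1)); first by rewrite ltrDl.
  by exists (t, s) => //; split=> //; split; rewrite /= in_itv /= ?andbT.
have [n [nM w1 w0]] := winding j (Num.truncn M).+1.
have Mn : M < n%:R.
  by apply: lt_le_trans (truncnS_gt _) _; rewrite ler_nat.
have n0 : 0 <= n%:R :> R by exact: ler0n.
have UT s : 0 <= s <= 1 -> U j (H' (n%:R, s)) = 1.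
  move=> s01; apply: KU; rewrite H'E // => /(HM _ _ n0 s01); lra.
have c2 m : continuous (fun t : R => 2 * pi * path_lift (c j) 1%g m t).
  by move=> t; apply: cvgM; [exact: cvg_cst|exact: continuous_path_lift].
have i0 : 0 <= (0 : R) <= 1 by rewrite lexx ler01.
have i1 : 0 <= (1 : R) <= 1 by rewrite lexx ler01.
have base m t (k : nat -> S * bool) : 0 <= t <= n%:R -> m = ray rels k t ->
   U j m = cos (2 * pi * path_lift (c j) 1%g (mkseq k n) t) /\
   sin (2 * pi * lam j m) = sin (2 * pi * path_lift (c j) 1%g (mkseq k n) t).
  move=> /andP[t0 tn] ->; rewrite (rayE _ _ tn); case: (Hlam j) => _ _ + _ _.
  exact.
have bot t : 0 <= t <= n%:R -> H' (t, 0) = ray rels l t.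
  by move=> /andP[t0 tn]; rewrite H'E // H0.
have top t : 0 <= t <= n%:R -> H' (t, 1) = ray rels l' t.
  by move=> /andP[t0 tn]; rewrite H'E // H1.
have n00 : 0 <= (0 : R) <= n%:R by rewrite lexx n0.
pose A m t : R := 2 * pi * path_lift (c j) 1%g (mkseq m n) t.
(* The cosine is positive on the side t = 0 by [Hj] and equal to 1 on the side t = n > M by [UT], so
   the total angles along the two rays up to time n agree. They are 2 pi and 0. *)
have E : A l n%:R - A l 0 = A l' n%:R - A l' 0.
  apply: (@circle_square R (U j \o H') (fun p => sin (2 * pi * lam j (H' p)))) => //.
  - by move=> p; apply: continuous_comp; [exact: cH'|exact: cU].
  - move=> p; apply: (@continuous_comp _ _ _ H' (fun x => sin (2 * pi * lam j x))).
      exact: cH'.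
    by case: (Hlam j) => _ cs _ _ _; exact: cs.
  - by move=> p; exact: cos2Dsin2.
  - exact: c2.
  - exact: c2.
  - by move=> t tn; exact: (base _ _ l tn (bot _ tn)).
  - by move=> t tn; exact: (base _ _ l' tn (top _ tn)).
  - move=> s s01; split; last by rewrite /= UT.
    exact: Hj.
  - split; rewrite /= ?UT //.
      case: (base _ 0 l n00 (bot _ n00)) => -> _.
      by rewrite path_lift_le0 // mulr0 cos0.
    case: (base _ 0 l' n00 (top _ n00)) => -> _.
    by rewrite path_lift_le0 // mulr0 cos0.
have z m : path_lift (c j) 1%g m (0 : R) = 0 by exact: path_lift_le0.
move: E; rewrite /A !z !path_lift_ge ?size_mkseq // w1 w0.
by have := @pi_gt0 R; lra.
Qed.

End Winding.
End Main.

Theorem theorem3p3 (R : realType) : ~ semistable_group R lamplighter.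
Proof.
move=> [S [rels [gen relP semi]]].
have [[w wred] wx] := gen lamp_x; rewrite /phi /= in wx.
have [n [Hw crel]] := fox_relators relP wx.
have w0 : (0 < size w)%N.
  by case: (w) wx => // /(congr1 hgt); rewrite hgt1 hgt_x.
have l0 : S * bool by case: (w) w0.
have sw : size (winv w) = size w by rewrite size_rev size_map.
(* As [w] spells x over S, the two rays pass through the nonnegative and the nonpositive powers of x
   at the multiples of [size w]. *)
pose l := cycle_nth l0 w; pose l' := cycle_nth l0 (winv w).
pose c j := @fox_cochain S n (lamp_x ^+ j)%g.
apply: (@ray_not_homotopic R _ S rels c l l').
- by move=> j g r; exact: crel.
- by move=> j; exact: finite_support_fox_cochain.
- by move=> g s; exact: fox_cochain_eventually0.
(* A multiple of [size w] makes each prefix a power of [w] or of its inverse; an exponent of at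
   least j + 1 takes the first ray beyond x^j. *)
- move=> j N; exists (maxn N j.+1 * size w)%N; split.
  + by apply: leq_trans (leq_maxl N j.+1) _; rewrite leq_pmulr.
  + rewrite cycle_nthM // -(expg0 lamp_x) path_val_fox_power // add0n.
    by rewrite (leq_trans (ltnSn j)) // leq_maxr.
  + rewrite -sw cycle_nthM ?sw // -(invg1 lamplighter) -(expg0 lamp_x).
    exact: path_val_fox_powerV.
- apply: semi.
  + apply: (@proper_ray R _ S rels relP l (fun g => 1 * hgt g)).
    by apply: hgt_cycle_nth_unbounded; rewrite // wx hgt_x.
  + apply: (@proper_ray R _ S rels relP l' (fun g => -1 * hgt g)).
    by apply: hgt_cycle_nth_unbounded; rewrite ?sw // weval_winv wx hgtV hgt_x.
Qed.
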